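(* The string coproduct on the lens spaces $L(k,7)$ detects Whitehead torsion. More precisely, let $f\colon L(k,7)\to L(k',7)$ be an orientation-preserving homotopy equivalence with Whitehead torsion $\tau(f)\in Wh(\mathbb{Z}_7)$. Then the restriction of the string coproduct to $H_3(LM)$, regarded after passing to quotients as a map $\mathbb{Z}[\mathbb{Z}_7]\cong H_3(LM)/K\to \big(H_1(LM,M)\otimes H_0(LM,M)\big)/\Delta(K)$, satisfies $$\Delta f(x)=f(\Delta(x))+f\big(x\star d\log\tau(f)\big)$$ for all $x\in H_3(LM)/K$, $M=L(k,7)$. Moreover, two elements of $Wh(\mathbb{Z}_7)$ give the same correction term (i.e. the same map $x\mapsto x\star d\log\tau$ on $H_3(LM)/K$ with values in this quotient) if and only if they are equal under the Dennis trace map.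
   Context: Lens space. Write $\mathbf e(s)=e^{2\pi i s}$. For $k\in\{1,\dots,6\}$, $L(k,7)$ is the quotient of $S^3=\{(z_1,z_2)\in\mathbb{C}^2:|z_1|^2+|z_2|^2=1\}$ by the $\mathbb{Z}_7$-action generated by $(z_1,z_2)\mapsto(\mathbf e(1/7)z_1,\mathbf e(k/7)z_2)$, with the induced orientation. The canonical generator of $\pi_1(M)=H_1(M)=\mathbb{Z}_7$ is the class of $s\mapsto(\mathbf e(s),0)$, $s\in[0,\tfrac17]$. Homology is integral. $LM=\mathrm{Map}(S^1,M)$ is the free loop space, with components $L_lM$, $l\in\mathbb{Z}_7$; $M\subset LM$ denotes the constant loops. Evaluation $L_lM\to M$ induces $H_1(L_lM)\cong H_1(M)=\mathbb{Z}_7$. String coproduct. Let $M$ be a closed oriented manifold of dimension $n$. For a class in $H_p(LM)$ represented by a map $\alpha\colon N\to LM$ from a closed oriented $p$-manifold, written $\alpha(t,x)$ with $t\in S^1=\mathbb{R}/\mathbb{Z}$, $x\in N$, and subject to transversality (the derivative in $t$ is non-zero at $t=0$, and $(x,t)\mapsto(\alpha(0,x),\alpha(t,x))$, $t\in(0,1)$, meets the diagonal of $M\times M$ transversely in a compact submanifold), put $V=\{(t,x):\alpha(t,x)=\alpha(0,x),\ t\neq0\}$, an oriented manifold of dimension $p+1-n$. Then $\Delta(\alpha)$ is the class of $V\to LM\times LM$, $(t,x)\mapsto(s\mapsto\alpha(st,x),\ s\mapsto\alpha(t+(1-t)s,x))$, in $H_{p-n+1}(LM\times LM,\,LM\times M\cup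 M\times LM)$. It depends only on the image of the class in $H_p(LM,M)$. Here only the component $\Delta\colon H_3(LM)\to H_1(LM,M)\otimes H_0(LM,M)$ is considered. Identifications. $H_1(LM)=\bigoplus_l H_1(L_lM)$ is identified with $\Omega^1=\mathbb{F}_7[t]/(t^7-1)\,\frac{dt}{t}$, with $t^l\frac{dt}{t}$ corresponding to the canonical generator of $H_1(L_lM)\cong H_1(M)$; $H_1(LM,M)=\Omega^1/\langle\frac{dt}{t}\rangle$; $H_0(LM)=\mathbb{Z}[\mathbb{Z}_7]$; $H_0(LM,M)=\mathbb{Z}[\mathbb{Z}_7]/\mathbb{Z}\cdot 1$. The element $t^pt_2^q\frac{dt}{t}$ (exponents mod $7$) denotes the class in $H_1(L_pM)\otimes H_0(L_qM)\cong\mathbb{Z}_7$ corresponding to the canonical generator of $H_1(M)$. Let $K$ be the kernel of $H_3(LM)\to\bigoplus_{i\in\mathbb{Z}_7}H_3(M)$ (evaluation at $0$ on each component). The map $\Delta$ descends to $H_3(LM)/K\to (H_1(LM,M)\otimes H_0(LM,M))/\Delta(K)$. The source is identified with $\mathbb{Z}[\mathbb{Z}_7]$ ($t^l$ corresponding to lifts of $[M]$ to $H_3(L_lM)$), and the target with the quotient of the $\mathbb{F}_7$-span of the $t^pt_2^q\frac{dt}{t}$ by the span of all $t^l\frac{dt}{t}$, $t_2^l\frac{dt}{t}$ and $t^l(t\,t_2^6+\dots+t^6t_2+t^7)\frac{dt}{t}$. A homotopy equivalence $f$ with $f_*(t)=t^a$ on $\pi_1$ acts on these spaces by $t\mapsto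 t^a$, $t_2\mapsto t_2^a$, $\frac{dt}{t}\mapsto a\frac{dt}{t}$. Whitehead torsion and Dennis trace. $Wh(\mathbb{Z}_7)=\mathbb{Z}[\mathbb{Z}_7]^\times/\mathbb{Z}_7$. With $R_k=(t^r-1)(t-1)$, $r=k^{-1}$ mod $7$, the Reidemeister torsion of $L(k,7)$, the convention for the Whitehead torsion is $R_{k'}=f(R_k\,\tau(f))$. The Dennis trace map is $Wh(\mathbb{Z}_7)\to HH_1(\mathbb{Z}[\mathbb{Z}_7])/HH_1(\mathbb{Z}[\mathbb{Z}_7],\mathbb{Z})=\Omega^1/\langle\tfrac{dt}{t}\rangle=H_1(LM,M)$, $\alpha\mapsto\alpha^{-1}d\alpha=d\log\alpha$. In the formula, $d\log\tau(f)$ denotes its further image under the map induced by the diagonal $LM\to LM\times LM$ followed by reversal of loops in the second factor, i.e. $t^j\frac{dt}{t}\mapsto t^jt_2^{-j}\frac{dt}{t}$. The string product $\star$ is applied to both factors as a derivation: if $x$ corresponds to $t^l$ then $x\star d\log\tau$ is $(t^l-t_2^l)\,d\log\tau$, i.e. if $d\log\tau=\sum_j c_jt^j\frac{dt}{t}$ it is $\sum_jc_j\big(t^{l+j}t_2^{-j}-t^jt_2^{l-j}\big)\frac{dt}{t}$. *)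

(* Defs.v *)
From HB Require Import structures.
From mathcomp Require Import all_boot all_order all_algebra.
From mathcomp Require Import ring.
From mathcomp Require Import all_classical all_reals all_analysis.

Set Implicit Arguments.
Unset Strict Implicit.
Unset Printing Implicit Defensive.

Import Order.TTheory GRing.Theory Num.Theory.
Import numFieldNormedType.Exports.
Local Open Scope classical_set_scope.
Local Open Scope ring_scope.
Local Open Scope quotient_scope.

(* The group Z_7 = pi_1(L(k,7)) is written additively as 'F_7, whose
   multiplication serves for the substitutions t |-> t^a.  The coefficients of
   1-forms also lie in 'F_7, so that a homology class m in H_1(M) = Z_7 is
   directly the coefficient m of a form. *)

(** * Lens spaces *)

Section Sphere.
Variable R : realType.

(* C^2 is 'rV[R]_4, with z_1 = z 0 0 + i z 0 1 and z_2 = z 0 2 + i z 0 3. *)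
Definition dot (u v : 'rV[R]_4) : R := (u *m v^T) 0 0.

Definition sphere : set 'rV[R]_4 := [set z | dot z z = 1].

(* (z_1, z_2) |-> (e(a) z_1, e(b) z_2), where e(s) = exp(2 pi i s). *)
Definition rotate (a b : R) (z : 'rV[R]_4) : 'rV[R]_4 :=
  let A := 2 * pi * a in let B := 2 * pi * b in
  \row_(i < 4) [:: cos A * z 0 0 - sin A * z 0 1;
                   sin A * z 0 0 + cos A * z 0 1;
                   cos B * z 0 (inord 2) - sin B * z 0 (inord 3);
                   sin B * z 0 (inord 2) + cos B * z 0 (inord 3)]`_i.

(* The j-th power of (z_1, z_2) |-> (e(1/7) z_1, e(k/7) z_2). *)
Definition deck (k j : 'F_7) : 'rV[R]_4 -> 'rV[R]_4 :=
  rotate (j%:R / 7) ((k * j)%N%:R / 7).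

Definition lens_rel (k : 'F_7) : rel sphere :=
  fun z w => [exists j : 'F_7, val w == deck k j (val z)].

Lemma cos_mod7 (m n : nat) : (m = n %[mod 7])%N ->
  cos (2 * pi * (m%:R / 7)) = cos (2 * pi * (n%:R / 7)) :> R.
Proof.
suff red p : cos (2 * pi * (p%:R / 7)) =
             cos (2 * pi * ((p %% 7)%N%:R / 7)) :> R.
  by move=> mn; rewrite red mn -red.
rewrite {1}(divn_eq p 7) natrD natrM [X in _ * X]mulrDl mulfK ?pnatr_eq0//.
rewrite mulrDr addrC.
have -> : 2 * pi * (p %/ 7)%:R = (pi *+ 2) *+ (p %/ 7) :> R.
  by rewrite mulr_natr mulr_natl.
by rewrite periodicn//; exact: cosD2pi.
Qed.

Lemma sin_mod7 (m n : nat) : (m = n %[mod 7])%N ->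
  sin (2 * pi * (m%:R / 7)) = sin (2 * pi * (n%:R / 7)) :> R.
Proof.
suff red p : sin (2 * pi * (p%:R / 7)) =
             sin (2 * pi * ((p %% 7)%N%:R / 7)) :> R.
  by move=> mn; rewrite red mn -red.
rewrite {1}(divn_eq p 7) natrD natrM [X in _ * X]mulrDl mulfK ?pnatr_eq0//.
rewrite mulrDr addrC.
have -> : 2 * pi * (p %/ 7)%:R = (pi *+ 2) *+ (p %/ 7) :> R.
  by rewrite mulr_natr mulr_natl.
by rewrite periodicn//; exact: sinD2pi.
Qed.

Lemma rotateD a b c d z :
  rotate a b (rotate c d z) = rotate (a + c) (b + d) z.
Proof.
apply/rowP; case=> -[|[|[|[|//]]]] i; rewrite !mxE /= ?inordK//= !mulrDr.
- by rewrite cosD sinD; ring.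
- by rewrite cosD sinD; ring.
- by rewrite cosD sinD; ring.
- by rewrite cosD sinD; ring.
Qed.

Lemma rotate0 z : rotate 0 0 z = z.
Proof.
apply/rowP => i; rewrite mxE mulr0 cos0 sin0 !mul1r !mul0r !subr0 !add0r.
by case: i => -[|[|[|[|//]]]] i /=; congr (z _ _); apply: val_inj;
  rewrite /= ?inordK.
Qed.

Lemma deckD k i j z : deck k i (deck k j z) = deck k (i + j) z.
Proof.
rewrite /deck rotateD -!mulrDl -!natrD -mulnDr /rotate.
have e1 : (i + j = (i + j)%R %[mod 7])%N by rewrite /= modn_mod.
have e2 : (k * (i + j) = k * (i + j)%R %[mod 7])%N.
  by rewrite /= modnMmr.
by rewrite (cos_mod7 e1) (cos_mod7 e2) (sin_mod7 e1) (sin_mod7 e2).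
Qed.

Lemma deck0 k z : deck k 0 z = z.
Proof. by rewrite /deck muln0 mul0r rotate0. Qed.

Lemma lens_rel_equiv (k : 'F_7) : equiv_class_of (lens_rel k).
Proof.
have sym z w : lens_rel k z w -> lens_rel k w z.
  move=> /existsP[j /eqP e]; apply/existsP; exists (- j).
  by rewrite e deckD addNr deck0.
split=> [z|z w|w z v].
- by apply/existsP; exists 0; rewrite deck0.
- by apply/idP/idP; exact: sym.
- move=> /existsP[i /eqP e] /existsP[j /eqP f]; apply/existsP; exists (j + i).
  by rewrite f e deckD.
Qed.

Canonical lens_equiv (k : 'F_7) := EquivRelPack (lens_rel_equiv k).
Canonical lens_encModRel (k : 'F_7) := defaultEncModRel (lens_rel k).

Lemma sphere_circle (s : R) : sphere (rotate s 0 (delta_mx 0 0)).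
Proof.
rewrite /sphere /dot /= !mxE !big_ord_recl big_ord0 !mxE /=.
have -> : (inord 2 == 0 :> 'I_4) = false by rewrite -val_eqE /= inordK.
have -> : (inord 3 == 0 :> 'I_4) = false by rewrite -val_eqE /= inordK.
by rewrite !(mulr1, mulr0, subr0, addr0) -!expr2 cos2Dsin2.
Qed.

Definition circle1 (s : R) : sphere :=
  SigSub (mem_set (sphere_circle s)).

Definition lens (k : 'F_7) : topologicalType :=
  quotient_topology {eq_quot lens_rel k}.

Definition lens_proj (k : 'F_7) (z : sphere) : lens k := \pi_(lens k) z.

(** * Homotopy theory of lens spaces *)

Definition homotopic (X Y : topologicalType) (f g : X -> Y) : Prop :=
  exists H : R * X -> Y,
    [/\ continuous H, forall x, H (0, x) = f x & forall x, H (1, x) = g x].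

Definition homotopy_equivalence (X Y : topologicalType) (f : X -> Y) : Prop :=
  continuous f /\
  exists g : Y -> X,
    [/\ continuous g, homotopic (g \o f) id & homotopic (f \o g) id].

(* Loops are 1-periodic functions on R. *)
Definition freely_homotopic (X : topologicalType) (c d : R -> X) : Prop :=
  exists H : R * R -> X,
    [/\ continuous H, forall u s, H (u, s + 1) = H (u, s),
        forall s, H (0, s) = c s & forall s, H (1, s) = d s].

(* The loop s |-> (e(l s/7), 0) of class t^l. *)
Definition std_loop (k l : 'F_7) (s : R) : lens k :=
  lens_proj k (circle1 (l%:R * s / 7)).

(* f_*(t) = t^a; fundamental groups being abelian, free homotopy is enough. *)
Definition pi1_action (k k' : 'F_7) (f : lens k -> lens k') (a : 'F_7) : Prop :=
  freely_homotopic (f \o std_loop k 1) (std_loop k' a).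

Definition C1 (V W : normedModType R) (F : V -> W) : Prop :=
  (forall x, differentiable F x) /\ (forall v, continuous (fun x => 'd F x v)).

(* For F mapping the sphere to itself: the determinant of dF on the tangent
   spaces of the sphere at z and F(z), extended by the outward normal. *)
Definition sphere_det (F : 'rV[R]_4 -> 'rV[R]_4) (z : 'rV[R]_4) : R :=
  \det (lin1_mx (fun v => 'd F z (v - dot v z *: z) + dot v z *: F z)).

(* f has degree 1, the degree being the signed number of preimages of a
   regular value y of a C^1 lift S^3 -> S^3 of f, up to homotopy; both
   coverings S^3 -> L(k,7), S^3 -> L(k',7) are oriented of degree 7. *)
Definition orientation_preserving (k k' : 'F_7) (f : lens k -> lens k') : Prop :=
  exists (F : 'rV[R]_4 -> 'rV[R]_4) (F3 : sphere -> sphere)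
         (y : sphere) (r : seq sphere),
    [/\ C1 F, forall z, val (F3 z) = F (val z),
        homotopic (f \o lens_proj k) (lens_proj k' \o F3),
        uniq r /\ forall z, F3 z = y <-> z \in r
      & (forall z, z \in r -> sphere_det F (val z) != 0) /\
        \sum_(z <- r) Num.sg (sphere_det F (val z)) = 1].

(** * Geometric description of the string coproduct *)

(* A smooth section alpha : M -> L_l M of the evaluation at 0, M = L(k,7), that
   is a representative in H_3(L_l M) of a lift of [M].  It is given by the lift
   A(z, t) of alpha(t, x) to the universal cover S^3 with A(z, 0) = z, which is
   equivariant by uniqueness of lifts; the loops alpha(., x) have class t^l when
   their lifts satisfy A(z, 1) = g^l z.  A is taken on R^4 x R, so that it can
   be differentiated, but only its restriction to S^3 x R matters. *)
Definition loop_section (k l : 'F_7) (A : 'rV[R]_4 * R -> 'rV[R]_4) : Prop :=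
  C1 A /\
  forall z, sphere z ->
    [/\ A (z, 0) = z, forall t, sphere (A (z, t)),
        forall t, A (z, t + 1) = deck k l (A (z, t))
      & forall t, A (deck k 1 z, t) = deck k 1 (A (z, t))].

(* The self-intersections alpha(t, x) = alpha(0, x), 0 < t < 1, for which the
   loop s |-> alpha(s t, x) has class t^p; the class of the loop
   s |-> alpha(t + (1 - t) s, x) is then t^(l - p). *)
Definition self_intersection (k : 'F_7) (A : 'rV[R]_4 * R -> 'rV[R]_4)
    (p : 'F_7) : set ('rV[R]_4 * R) :=
  [set q | [/\ sphere q.1, 0 < q.2 < 1 & A q = deck k p q.1]].

(* At such a point, the derivative of alpha(t, x) minus that of alpha(0, x),
   i.e. the derivative of (alpha(0, x), alpha(t, x)) modulo the tangent space of
   the diagonal, read in the tangent space of S^3 at A(z, t) = g^p z. *)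
Definition normal_derivative (k : 'F_7) (A : 'rV[R]_4 * R -> 'rV[R]_4)
    (p : 'F_7) (q w : 'rV[R]_4 * R) : 'rV[R]_4 :=
  'd A q w - deck k p w.1.

Definition transverse (k : 'F_7) (A : 'rV[R]_4 * R -> 'rV[R]_4) : Prop :=
  (forall z, sphere z -> 'd A (z, 0) (0, 1) != 0) /\
  (forall p q, self_intersection k A p q ->
     forall u, dot u (A q) = 0 ->
     exists2 w, dot w.1 q.1 = 0 & normal_derivative k A p q w = u).

Definition rowDet4 (v1 v2 v3 v4 : 'rV[R]_4) : R :=
  \det (\matrix_(i < 4) [:: v1; v2; v3; v4]`_i).

Definition rowDet5 (w1 w2 w3 w4 w5 : 'rV[R]_4 * R) : R :=
  let coord (w : 'rV[R]_4 * R) : 'rV[R]_5 := row_mx w.1 (w.2%:M : 'rV_1) in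
  \det (\matrix_(i < 5) [:: coord w1; coord w2; coord w3; coord w4; coord w5]`_i).

(* Orientation of the self-intersection manifold V.  Spheres are oriented by
   the outward normal, M x (0,1) is oriented as a product, and w tangent to V is
   positive when completing it by vectors w1, w2, w3 that the normal derivative
   maps to a positive basis gives a positive basis of T(M x (0,1)). *)
Definition positive_tangent (k : 'F_7) (A : 'rV[R]_4 * R -> 'rV[R]_4)
    (p : 'F_7) (q w : 'rV[R]_4 * R) : Prop :=
  exists w1 w2 w3 : 'rV[R]_4 * R,
    let N := normal_derivative k A p q in
    [/\ dot w1.1 q.1 = 0, dot w2.1 q.1 = 0, dot w3.1 q.1 = 0,
        0 < rowDet4 (A q) (N w1) (N w2) (N w3)
      & 0 < rowDet5 (q.1, 0) w w1 w2 w3].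

(* A positively parametrized closed curve of V, s |-> c(s) lifted to S^3; it
   lies over a loop of M of class m. *)
Definition oriented_circle (k : 'F_7) (A : 'rV[R]_4 * R -> 'rV[R]_4)
    (p m : 'F_7) (c : R -> 'rV[R]_4 * R) : Prop :=
  C1 c /\
  forall s, [/\ self_intersection k A p (c s),
    c (s + 1) = (deck k m (c s).1, (c s).2)
    & positive_tangent k A p (c s) ('d c s 1)].

End Sphere.

(** * The algebraic models *)

(* Z[Z_7] *)
Definition ZG := {ffun 'F_7 -> int}.

(* F_7[t]/(t^7 - 1) dt/t; the function c stands for sum_j c_j t^j dt/t. *)
Definition Omega := {ffun 'F_7 -> ('F_7)^o}.

(* The F_7-span of the t^p t_2^q dt/t. *)
Definition Omega2 := {ffun 'F_7 * 'F_7 -> ('F_7)^o}.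

Definition gen (p q : 'F_7) : Omega2 := [ffun x => (x == (p, q))%:R].

(* t^l, t_2^l and t^l (t t_2^6 + ... + t^6 t_2 + t^7), all times dt/t. *)
Definition target_relations : seq Omega2 :=
  [seq gen l 0 | l : 'F_7] ++ [seq gen 0 l | l : 'F_7] ++
  [seq \sum_(j : 'F_7) gen (l + j) (- j) | l : 'F_7].

(* (H_1(LM, M) (x) H_0(LM, M)) / Delta(K) *)
Definition target := Quotient.quot (pred_of_vspace <<target_relations>>%VS).

Definition tpow (l : 'F_7) : ZG := [ffun i => (i == l)%:R].

Definition conv (S : pzRingType) (x y : {ffun 'F_7 -> S}) : {ffun 'F_7 -> S} :=
  [ffun n => \sum_i x i * y (n - i)].

(* t |-> t^a *)
Definition push (a : 'F_7) (x : ZG) : ZG := [ffun n => \sum_(i | a * i == n) x i].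

(* t |-> t^a, t_2 |-> t_2^a, dt/t |-> a dt/t *)
Definition push2 (a : 'F_7) (y : Omega2) : Omega2 :=
  \sum_p \sum_q (a * y (p, q)) *: gen (a * p) (a * q).

(* push2 preserves the relations, so the choice of representative is
   immaterial. *)
Definition target_push (a : 'F_7) (y : target) : target :=
  \pi_target (push2 a (repr y)).

(** * Whitehead torsion and Dennis trace *)

(* A unit of Z[Z_7] together with its inverse. *)
Definition ZG_unit := {u : ZG * ZG | conv u.1 u.2 == tpow 0}.

(* t^i x *)
Definition shift (i : 'F_7) (x : ZG) : ZG := [ffun n => x (n - i)].

Definition Wh_rel : rel ZG_unit :=
  fun u v => [exists i, (val v).1 == shift i (val u).1].

Lemma Wh_rel_equiv : equiv_class_of Wh_rel.
Proof.
have shiftD i j x : shift i (shift j x) = shift (i + j) x.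
  by apply/ffunP => n; rewrite !ffunE opprD addrA.
have shift0 x : shift 0 x = x by apply/ffunP => n; rewrite !ffunE subr0.
have sym u v : Wh_rel u v -> Wh_rel v u.
  move=> /existsP[i /eqP e]; apply/existsP; exists (- i).
  by rewrite e shiftD addNr shift0.
split=> [u|u v|v u w].
- by apply/existsP; exists 0; rewrite shift0.
- by apply/idP/idP; exact: sym.
- move=> /existsP[i /eqP e] /existsP[j /eqP f]; apply/existsP; exists (j + i).
  by rewrite f e shiftD.
Qed.

Canonical Wh_equiv := EquivRelPack Wh_rel_equiv.
Canonical Wh_encModRel := defaultEncModRel Wh_rel.

(* Z[Z_7]^x / Z_7 *)
Definition Wh := {eq_quot Wh_rel}.

Definition Wh_val (tau : Wh) : ZG := (val (repr tau)).1.

(* (t^r - 1)(t - 1), r = 1/k mod 7 *)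
Definition reidemeister (k : 'F_7) : ZG :=
  conv (tpow k^-1 - tpow 0) (tpow 1 - tpow 0).

(* R_k' = f(R_k tau), up to Z_7, where f_*(t) = t^a.  Torsions live in the
   quotient of Z[Z_7] by the norm element, but both sides have augmentation 0,
   so that they agree there if and only if they agree in Z[Z_7]. *)
Definition is_whitehead_torsion (k k' a : 'F_7) (tau : Wh) : Prop :=
  exists i, reidemeister k' = shift i (push a (conv (reidemeister k) (Wh_val tau))).

(* alpha^-1 d alpha, where d t^j = j t^j dt/t *)
Definition dlog (u : ZG_unit) : Omega :=
  conv [ffun j => ((val u).2 j)%:~R : ('F_7)^o]
       [ffun j => j * ((val u).1 j)%:~R : ('F_7)^o].

Definition dt_over_t : Omega := [ffun j => (j == 0)%:R].

(* H_1(LM, M) = Omega^1 / <dt/t> *)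
Definition Omega_rel := Quotient.quot (pred_of_vspace <[dt_over_t]>%VS).

Definition dennis_trace (tau : Wh) : Omega_rel := \pi_Omega_rel (dlog (repr tau)).

Definition star (x : ZG) (c : Omega) : Omega2 :=
  \sum_l \sum_j ((x l)%:~R * c j) *: (gen (l + j) (- j) - gen j (l - j)).

(* x * dlog(tau); changing the representative of tau changes dlog(tau) by a
   multiple of dt/t, hence star by an element of the relations. *)
Definition correction (x : ZG) (tau : Wh) : target :=
  \pi_target (star x (dlog (repr tau))).

(** * The string coproduct *)

(* y is the class of V for the section A: V is the disjoint union of n oriented
   circles, each point of V being hit exactly once up to deck transformations,
   and a circle with parameters p, m contributes m t^p t_2^(l - p) dt/t. *)
Definition coproduct_class (R : realType) (k l : 'F_7)
    (A : 'rV[R]_4 * R -> 'rV[R]_4) (y : Omega2) : Prop :=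
  exists (n : nat) (p m : 'I_n -> 'F_7) (c : 'I_n -> R -> 'rV[R]_4 * R),
    [/\ forall i, oriented_circle k A (p i) (m i) (c i),
        forall r q, self_intersection k A r q ->
          exists! ic : 'I_n * R,
            [/\ p ic.1 = r, 0 <= ic.2 < 1
              & exists j, q = (deck k j (c ic.1 ic.2).1, (c ic.1 ic.2).2)]
      & y = \sum_i m i *: gen (p i) (l - p i)].

(* Delta : H_3(LM)/K = Z[Z_7] -> (H_1(LM, M) (x) H_0(LM, M))/Delta(K) for
   M = L(k,7) is the string coproduct: on t^l it is computed by every transverse
   section of L_l M -> M. *)
Definition is_string_coproduct (R : realType) (k : 'F_7)
    (Delta : {additive ZG -> target}) : Prop :=
  forall (l : 'F_7) (A : 'rV[R]_4 * R -> 'rV[R]_4) (y : Omega2),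
    loop_section k l A -> transverse k A -> coproduct_class k l A y ->
    Delta (tpow l) = \pi_target y.

(* Main.v *)
(** Put x = t / t_2, let N be the norm element and D = t d/dt.  Multiplying by
    t_2^l, a form c(x) represents a class over t^l, and the relations of the
    target say that 1, x^l and N vanish there.

    The linear loops s |-> (e(al s / 7) z_1, e(be s / 7) z_2) with al = l and
    be = k l mod 7 form a transverse section of L_l M as soon as
    be = k' al + 7 for the lift k' of k.  Its self-intersections are the circle
    z_2 = 0 at the times j / al and the circle z_1 = 0 at the times j / be, all
    with the orientation of C.  They sum up to
    x + ... + x^(al - 1) + r (x^r + ... + x^(r (be - 1))) with r = 1/k, which is
    formally (x^l - 1) dlog R_k.  So the formula is the logarithmic derivative of
    R_k' = f(R_k tau).  As x - 1 is not invertible, that identity is first divided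
    by (x - 1)^2 over the integers, which determines the quotient up to
    multiples of N, and (x^l - 1) D N = - l N vanishes in the target.

    Modulo dt/t, the forms c with (x^l - 1) c = 0 in the target for all l are
    spanned by N and D N.  Let c = dlog u for an integral unit u.  With u* the
    image of u under t |-> 1/t, w = u / u* satisfies w w* = 1, so w is t^i up to
    sign; hence c is antisymmetric up to dt/t, which excludes N.  The product of
    the Galois conjugates of u is 1 or -1, so that the conjugates of c sum up to
    0, which excludes D N. *)

Require Import Defs.
From HB Require Import structures.
From mathcomp Require Import all_boot all_order all_algebra.
From mathcomp Require Import ring lra zify.
From mathcomp Require Import all_classical all_reals all_analysis.

Set Implicit Arguments.
Unset Strict Implicit.
Unset Printing Implicit Defensive.

Import Order.TTheory GRing.Theory Num.Theory.
Import numFieldNormedType.Exports.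
Local Open Scope classical_set_scope.
Local Open Scope ring_scope.
Local Open Scope quotient_scope.

(** * The group ring of Z_7 *)

(* Functions on Z_7 with the convolution product [conv]: a copy of [ZG] or [Omega]
   carrying its ring structure. *)
Definition gring (S : comNzRingType) := {ffun 'F_7 -> S}.

HB.instance Definition _ (S : comNzRingType) := GRing.Zmodule.on (gring S).

Section GroupRing.
Variable S : comNzRingType.
Implicit Types x y z : gring S.

Definition gX (i : 'F_7) : gring S := [ffun n => (n == i)%:R].

Let gmul x y : gring S := @Defs.conv S x y.

Lemma gmulC x y : gmul x y = gmul y x.
Proof.
apply/ffunP => n; rewrite !ffunE (reindex_inj (subrI n)) /=.
by apply: eq_bigr => i _; rewrite subKr mulrC.
Qed.

Lemma gmulA x y z : gmul x (gmul y z) = gmul (gmul x y) z.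
Proof.
apply/ffunP => n; rewrite !ffunE.
under eq_bigr do rewrite ffunE big_distrr /=.
under [RHS]eq_bigr do rewrite ffunE big_distrl /=.
rewrite [RHS]exchange_big; apply: eq_bigr => i _.
rewrite [RHS](reindex_inj (addIr i)) /=; apply: eq_bigr => j _.
by rewrite addrK mulrA opprD addrA addrAC.
Qed.

Lemma gmul1 y : gmul (gX 0) y = y.
Proof.
apply/ffunP => n; rewrite ffunE (bigD1 0) //= ffunE eqxx mul1r subr0.
by rewrite big1 ?addr0 // => i /negPf i0; rewrite ffunE i0 mul0r.
Qed.

Lemma gmulDl x y z : gmul (x + y) z = gmul x z + gmul y z.
Proof.
by apply/ffunP => n; rewrite !ffunE -big_split; apply: eq_bigr => i _;
  rewrite ffunE mulrDl.
Qed.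

Lemma gX0_neq0 : gX 0 != 0.
Proof. by apply/eqP => /ffunP/(_ 0)/eqP; rewrite !ffunE oner_eq0. Qed.

HB.instance Definition _ := GRing.Zmodule_isComNzRing.Build (gring S)
  gmulA gmulC gmul1 gmulDl gX0_neq0.

Lemma gmulE x y n : (x * y) n = \sum_i x i * y (n - i). Proof. exact: ffunE. Qed.

Lemma gringDE x y n : (x + y) n = x n + y n. Proof. exact: ffunE. Qed.
Lemma gringNE x n : (- x) n = - x n. Proof. exact: ffunE. Qed.
Lemma gring0E n : (0 : gring S) n = 0. Proof. exact: ffunE. Qed.
Lemma gring1E n : (1 : gring S) n = (n == 0)%:R. Proof. exact: ffunE. Qed.
Lemma gXE i n : gX i n = (n == i)%:R. Proof. exact: ffunE. Qed.

Lemma gring_sumE (I : finType) (P : pred I) (F : I -> gring S) n :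
  (\sum_(i | P i) F i) n = \sum_(i | P i) F i n.
Proof. exact: sum_ffunE. Qed.

Lemma gXmulE i x n : (gX i * x) n = x (n - i).
Proof.
rewrite gmulE (bigD1 i) //= gXE eqxx mul1r big1 ?addr0 // => j /negPf ji.
by rewrite gXE ji mul0r.
Qed.

Lemma gXD i j : gX (i + j) = gX i * gX j.
Proof. by apply/ffunP => n; rewrite gXmulE !gXE subr_eq addrC. Qed.

Lemma gX0 : gX 0 = 1. Proof. by []. Qed.

Lemma gXn i n : gX i ^+ n = gX (i *+ n).
Proof. by elim: n => [|n IH]; rewrite ?expr0 // exprS IH mulrS gXD. Qed.

Definition gC (s : S) : gring S := [ffun n => if n == 0 then s else 0].

Lemma gCmulE s x n : (gC s * x) n = s * x n.
Proof.
rewrite gmulE (bigD1 0) //= ffunE eqxx subr0 big1 ?addr0 // => j /negPf j0.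
by rewrite ffunE j0 mul0r.
Qed.

Lemma gC_zmod_morphism : zmod_morphism gC.
Proof. by move=> s t; apply/ffunP => n; rewrite !ffunE; case: eqP; rewrite ?subr0. Qed.

Lemma gC_monoid_morphism : monoid_morphism gC.
Proof.
split=> [|s t]; apply/ffunP => n; first by rewrite !ffunE; case: eqP.
by rewrite gCmulE !ffunE; case: eqP; rewrite ?mulr0.
Qed.

HB.instance Definition _ :=
  GRing.isZmodMorphism.Build S (gring S) gC gC_zmod_morphism.
HB.instance Definition _ :=
  GRing.isMonoidMorphism.Build S (gring S) gC gC_monoid_morphism.

Lemma gring_decomp x : x = \sum_i gC (x i) * gX i.
Proof.
apply/ffunP => n; rewrite gring_sumE (bigD1 n) //= gCmulE gXE eqxx mulr1.
rewrite big1 ?addr0 // => j /negPf jn.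
by rewrite gCmulE gXE eq_sym jn mulr0.
Qed.

Definition norm_elt : gring S := [ffun=> 1].

Lemma norm_eltE n : norm_elt n = 1. Proof. exact: ffunE. Qed.

Lemma mul_norm x : x * norm_elt = gC (\sum_i x i) * norm_elt.
Proof.
apply/ffunP => n; rewrite gmulE gCmulE norm_eltE mulr1.
by apply: eq_bigr => i _; rewrite norm_eltE mulr1.
Qed.

Lemma mulX_norm i : gX i * norm_elt = norm_elt.
Proof. by apply/ffunP => n; rewrite gXmulE !norm_eltE. Qed.

(** Annihilation by t - 1 says that the coefficients are invariant under n |-> n + 1, hence all
    equal. *)
Lemma ann_X1 x : (gX 1 - 1) * x = 0 -> x = gC (x 0) * norm_elt.
Proof.
move=> x1; have step n : x (n + 1) = x n.
  have := congr1 (fun f : gring S => f (n + 1)) x1.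
  by rewrite mulrBl mul1r gringDE gringNE gXmulE gring0E addrK => /subr0_eq ->.
apply/ffunP => n; rewrite gCmulE norm_eltE mulr1.
rewrite -[n]natr_Zp; elim: (val n) => [//|m IH].
by rewrite -natr1 step.
Qed.

End GroupRing.

(** * Substitutions t |-> t^a *)

Section Pushforward.
Variables (S : comNzRingType) (a : 'F_7).
Implicit Types x y : gring S.

(** For a != 0 this is the substitution t |-> t^a, written coefficientwise. As the inverse of 0 is
    0, the formula makes sense and is additive for every a; the multiplicative laws below are for a
    != 0. *)
Definition gpush x : gring S := [ffun n => x (n / a)].

Lemma gpushE x n : gpush x n = x (n / a). Proof. exact: ffunE. Qed.

Lemma gpush_zmod_morphism : zmod_morphism gpush.
Proof. by move=> x y; apply/ffunP => n; rewrite !ffunE. Qed.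

HB.instance Definition _ :=
  GRing.isZmodMorphism.Build (gring S) (gring S) gpush gpush_zmod_morphism.

Lemma gpushB x y : gpush (x - y) = gpush x - gpush y.
Proof. exact: raddfB. Qed.

Lemma gpushD x y : gpush (x + y) = gpush x + gpush y.
Proof. exact: raddfD. Qed.

Lemma gpush_sum (I : finType) (P : pred I) (F : I -> gring S) :
  gpush (\sum_(i | P i) F i) = \sum_(i | P i) gpush (F i).
Proof. exact: raddf_sum. Qed.

Hypothesis a0 : a != 0.

Lemma gpushX i : gpush (gX S i) = gX S (a * i).
Proof.
apply/ffunP => n; rewrite gpushE !gXE; congr (nat_of_bool _)%:R.
by rewrite -(inj_eq (mulfI a0)) mulrC divfK.
Qed.

Lemma gpush1 : gpush 1 = 1. Proof. by rewrite -gX0 gpushX mulr0. Qed.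

Lemma gpushM x y : gpush (x * y) = gpush x * gpush y.
Proof.
apply/ffunP => n; rewrite gpushE !gmulE [RHS](reindex_inj (mulIf a0)) /=.
by apply: eq_bigr => i _; rewrite !gpushE mulfK // mulrBl mulfK.
Qed.

Lemma gpush_prod (I : finType) (P : pred I) (F : I -> gring S) :
  gpush (\prod_(i | P i) F i) = \prod_(i | P i) gpush (F i).
Proof. by apply: big_morph; [exact: gpushM | exact: gpush1]. Qed.

Lemma gpushC s : gpush (gC s) = gC s.
Proof.
by apply/ffunP => n; rewrite gpushE !ffunE mulf_eq0 invr_eq0 (negPf a0) orbF.
Qed.

End Pushforward.

Lemma gpush_comp (S : comNzRingType) (a b : 'F_7) (x : gring S) :
  gpush a (gpush b x) = gpush (a * b) x.
Proof. by apply/ffunP => n; rewrite !gpushE invfM mulrA. Qed.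

Notation A7 := (gring 'F_7).

(** * The group algebra over F_7: Frobenius and the derivation t d/dt *)

Section ModSeven.
Implicit Types x y : A7.

Lemma gring_pchar7 : 7 \in [pchar A7].
Proof.
have := pchar_Fp (isT : prime 7); rewrite !inE => /andP[-> /eqP F7].
by apply/eqP; rewrite -(rmorph_nat (@gC 'F_7)) F7 rmorph0.
Qed.

(** Frobenius in characteristic 7: the seventh power of t^i is 1, and s^7 = s in F_7. An element of
    non-zero augmentation is therefore a unit. *)
Lemma pow7 x : x ^+ 7 = gC (\sum_i x i).
Proof.
have F := pFrobenius_autE gring_pchar7.
rewrite -F {1}[x]gring_decomp (rmorph_sum (pFrobenius_aut gring_pchar7)) /=.
rewrite rmorph_sum; apply: eq_bigr => i _; rewrite F exprMn gXn.
have -> : i *+ 7 = 0 by rewrite -mulr_natr pchar_Fp_0 // mulr0.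
rewrite gX0 mulr1 -rmorphXn /=; congr (gC _).
by case: (x i) => -[|[|[|[|[|[|[|//]]]]]]] ?; apply/val_inj.
Qed.

(* t d/dt *)
Definition gder x : A7 := [ffun n => n * x n].

Lemma gderE x n : gder x n = n * x n. Proof. exact: ffunE. Qed.

Lemma gder_zmod_morphism : zmod_morphism gder.
Proof. by move=> x y; apply/ffunP => n; rewrite !ffunE mulrBr. Qed.

HB.instance Definition _ :=
  GRing.isZmodMorphism.Build A7 A7 gder gder_zmod_morphism.

Lemma gderM x y : gder (x * y) = gder x * y + x * gder y.
Proof.
apply/ffunP => n; rewrite gderE gringDE !gmulE big_distrr -big_split.
by apply: eq_bigr => i _; rewrite /= !gderE; ring.
Qed.

Lemma gderX i : gder (gX 'F_7 i) = gC i * gX 'F_7 i.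
Proof.
apply/ffunP => n; rewrite gderE gCmulE gXE.
by case: eqP => [->|_]; rewrite ?mulr0.
Qed.

Lemma gderC s : gder (gC s) = 0.
Proof.
apply/ffunP => n; rewrite gderE !ffunE.
by case: eqP => [->|_]; rewrite ?mul0r ?mulr0.
Qed.

Lemma gder1 : gder 1 = 0.
Proof. by rewrite -(rmorph1 (@gC 'F_7)) gderC. Qed.

Lemma gder_push (a : 'F_7) (a0 : a != 0) x :
  gder (gpush a x) = gC a * gpush a (gder x).
Proof.
apply/ffunP => n; rewrite gCmulE !(gderE, gpushE) mulrA mulrCA.
by rewrite mulfV // mulr1.
Qed.

End ModSeven.

(** * Reduction of integral coefficients modulo 7 *)

Section Reduction.

Definition gred (x : gring int) : A7 := [ffun n => (x n)%:~R].

Lemma gredE x n : gred x n = (x n)%:~R. Proof. exact: ffunE. Qed.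

Lemma gred_zmod_morphism : zmod_morphism gred.
Proof. by move=> x y; apply/ffunP => n; rewrite !ffunE rmorphB. Qed.

Lemma gred_monoid_morphism : monoid_morphism gred.
Proof.
split=> [|x y]; apply/ffunP => n.
  by rewrite gredE !gring1E; case: (n == 0).
rewrite gredE !gmulE rmorph_sum; apply: eq_bigr => i _.
by rewrite rmorphM !gredE.
Qed.

HB.instance Definition _ :=
  GRing.isZmodMorphism.Build (gring int) A7 gred gred_zmod_morphism.
HB.instance Definition _ :=
  GRing.isMonoidMorphism.Build (gring int) A7 gred gred_monoid_morphism.

Lemma gred_push a x : gred (gpush a x) = gpush a (gred x).
Proof. by apply/ffunP => n; rewrite !(gredE, gpushE). Qed.

Lemma gredX i : gred (gX _ i) = gX _ i.
Proof. by apply/ffunP => n; rewrite gredE !gXE; case: (n == i). Qed.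

Lemma gredC s : gred (gC s) = gC s%:~R.
Proof. by apply/ffunP => n; rewrite gredE !ffunE; case: ifP. Qed.

Lemma gred_norm : gred (norm_elt _) = norm_elt _.
Proof. by apply/ffunP => n; rewrite gredE !norm_eltE. Qed.

End Reduction.

(** * Logarithmic derivatives of integral units *)

Section IntegralUnits.
Variables u u' : gring int.
Hypothesis uu' : u * u' = 1.

(* The coefficient of 1 in w w* is the sum of the squares of those of w. *)
Lemma unit_norm1 (w : gring int) : w * gpush (-1) w = 1 ->
  exists i, w = gC (w i) * gX _ i.
Proof.
have n1 : (-1 : 'F_7) != 0 by [].
move=> /(congr1 (fun f : gring int => f 0)); rewrite gmulE gring1E eqxx.
under eq_bigr => i _ do rewrite gpushE sub0r invrN invr1 mulrN1 opprK.
move=> w2; have [i wi] : exists i, w i != 0.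
  apply/existsP; rewrite -[[exists _, _]]negbK negb_exists; apply/negP => /forallP w0.
  by move: w2; rewrite big1 // => i _; move: (w0 i); rewrite negbK => /eqP ->.
exists i; apply/ffunP => j; rewrite gCmulE gXE; case: eqP => [->|/eqP ji].
  by rewrite mulr1.
rewrite mulr0; move: w2; rewrite (bigD1 i) //= (bigD1 j) //=.
set s := \sum_(_ | _) _ => w2; have s0 : 0 <= s.
  by apply: sumr_ge0 => n _; rewrite -expr2 sqr_ge0.
(* The square of the non-zero integer w i is at least 1, which uses up the whole sum of squares. *)
by apply/eqP; move: wi w2 s0; clear; move: (w i) (w j) => a b; nia.
Qed.

Let c := gred u' * gder (gred u).

(** [unit_norm1], applied to the quotient of u by u(1/t), gives u = s t^i u(1/t) with a constant s.
    Taking dlog turns this into c = i - c(1/t), so that only the coefficient at 0 escapes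
    antisymmetry. *)
Lemma dlog_unit_odd j : j != 0 -> c (- j) = - c j.
Proof.
have n1 : (-1 : 'F_7) != 0 by [].
move=> j0; set t := gpush (-1) u; set t' := gpush (-1) u'; set w := u * t'.
have pp (x : gring int) : gpush (-1) (gpush (-1) x) = x.
  rewrite gpush_comp mulrNN mulr1; apply/ffunP => n.
  by rewrite gpushE invr1 mulr1.
have tt' : t * t' = 1 by rewrite -gpushM // uu' gpush1.
have [|i wi] := @unit_norm1 w.
  rewrite /w gpushM // pp -/t; transitivity ((u * u') * (t * t')); first by ring.
  by rewrite uu' tt' mulr1.
have ue : u = gC (w i) * gX _ i * t.
  by rewrite -wi -mulrA [t' * t]mulrC tt' mulr1.
have Duu : gred u' * gred u = 1 by rewrite -rmorphM mulrC uu' rmorph1.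
have Dtt : gred t * gred t' = 1 by rewrite -rmorphM tt' rmorph1.
have cE : c = gC i + gred t' * gder (gred t).
  pose s := gred (gC (w i)).
  have Ue : gred u = s * gX _ i * gred t by rewrite -gredX -!rmorphM -ue.
  have sE : s = gC (w i)%:~R.
    exact: gredC.
  have DU : gder (gred u) = gC i * gred u + s * gX _ i * gder (gred t).
    by rewrite Ue gderM gderM sE gderC gderX; ring.
  rewrite /c DU mulrDr mulrCA Duu mulr1; congr (_ + _).
  rewrite -[X in _ * (_ * X)]mul1r -Dtt.
  transitivity (gred u' * (s * gX _ i * gred t) * (gred t' * gder (gred t))).
    by ring.
  by rewrite -Ue Duu mul1r.
have tc : gred t' * gder (gred t) = - gpush (-1) c.
  rewrite /t /t' !gred_push gder_push // mulrCA -gpushM // -/c.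
  by apply/ffunP => n; rewrite gCmulE gringNE mulN1r.
rewrite {1}cE tc gringDE gringNE gpushE invrN invr1 mulrNN mulr1.
by rewrite ffunE oppr_eq0 (negPf j0) add0r.
Qed.

End IntegralUnits.

Lemma dlog_prod (I : finType) (P : pred I) (F F' : I -> gring 'F_7) :
  (forall i, P i -> F i * F' i = 1) ->
  (\prod_(i | P i) F' i) * gder (\prod_(i | P i) F i) =
  \sum_(i | P i) F' i * gder (F i).
Proof.
move=> FF'.
(* The induction carries along that the two partial products are inverse to each other. *)
pose K (x y z : gring 'F_7) := x * y = 1 /\ y * gder x = z.
suff [] : K (\prod_(i | P i) F i) (\prod_(i | P i) F' i)
  (\sum_(i | P i) F' i * gder (F i)) by [].
apply: (big_rec3 K); first by split; rewrite ?mulr1 // -(rmorph1 (@gC 'F_7)) gderC mulr0.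
move=> i x y z Pi [xy <-]; split.
  by transitivity ((F i * F' i) * (x * y)); [ring | rewrite FF' // xy mulr1].
rewrite gderM; transitivity (F' i * gder (F i) * (x * y) + F i * F' i * (y * gder x)).
  by ring.
by rewrite FF' // xy mulr1 mul1r.
Qed.

Lemma sum_F7 (V : nmodType) (G : 'F_7 -> V) :
  \sum_i G i = G 0 + G 1 + G 2 + G 3 + G 4 + G 5 + G 6.
Proof.
rewrite -!addrA !big_ord_recl big_ord0 addr0.
by do !congr (_ + _); congr G; apply/val_inj.
Qed.

(* A Galois invariant element is p + q N; if it is a unit then p and p + 7 q are
   both 1 or -1, whence q = 0. *)
Lemma unit_invariant (w w' : gring int) : w * w' = 1 ->
  (forall a : 'F_7, a != 0 -> gpush a w = w) ->
  (forall a : 'F_7, a != 0 -> gpush a w' = w') -> w = gC (w 0).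
Proof.
move=> ww' wP w'P.
have con (x : gring int) : (forall a : 'F_7, a != 0 -> gpush a x = x) ->
    forall n, n != 0 -> x n = x 1.
  by move=> xP n n0; rewrite -{1}(xP n n0) gpushE mulfV.
have e0 := congr1 (fun f : gring int => f 0) ww'.
have e1 := congr1 (fun f : gring int => f 1) ww'.
move: e0 e1; rewrite !gmulE !gring1E.
rewrite !sum_F7 !(con _ wP 2, con _ wP 3, con _ wP 4, con _ wP 5, con _ wP 6) //.
rewrite ?(subr0, sub0r, subrr).
rewrite !(con w' w'P (-1)) ?(con w' w'P (-2)) ?(con w' w'P (-3)) //.
rewrite ?(con w' w'P (-4)) ?(con w' w'P (-5)) ?(con w' w'P (-6)) //.
rewrite ?(con w' w'P (1-2)) ?(con w' w'P (1-3)) ?(con w' w'P (1-4)) //.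
rewrite ?(con w' w'P (1-5)) ?(con w' w'P (1-6)) //=.
move=> e0 e1.
suff q0 : w 1 = 0.
  apply/ffunP => n; rewrite ffunE; case: eqP => [->//|/eqP n0].
  by rewrite con.
move: e0 e1; clear; move: (w 0) (w 1) (w' 0) (w' 1) => p q p' q' e0 e1.
(* With p the coefficient at 0 and q the common coefficient elsewhere, p - q and p + 6 q are the
   values of w at a non-trivial seventh root of unity and at 1. Both are 1 or -1 and they differ by
   7 q. *)
have : (p - q) * (p' - q') = 1 by lia.
have : (p + 6 * q) * (p' + 6 * q') = 1 by lia.
have z1 (a b : int) : a * b = 1 -> a = 1 \/ a = -1.
  move=> ab; have : (`|a| * `|b| == 1)%N by rewrite -abszM ab.
  by rewrite muln_eq1 => /andP[/eqP a1 _]; lia.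
move=> /z1 h1 /z1 h2; lia.
Qed.

Section GaloisNorm.
Variables u u' : gring int.
Hypothesis uu' : u * u' = 1.

(** The product of all conjugates of u is a Galois invariant unit, hence a constant, and its
    derivative vanishes. By [gder_push], the conjugate of u under t |-> t^b contributes b times the
    conjugate of dlog u. *)
Lemma dlog_unit_galois :
  \sum_(b : 'F_7 | b != 0) gC b * gpush b (gred u' * gder (gred u)) = 0.
Proof.
pose w := \prod_(b : 'F_7 | b != 0) gpush b u.
pose w' := \prod_(b : 'F_7 | b != 0) gpush b u'.
have inv (x : gring int) (a : 'F_7) : a != 0 ->
    gpush a (\prod_(b : 'F_7 | b != 0) gpush b x) = \prod_(b : 'F_7 | b != 0) gpush b x.
  move=> a0; rewrite gpush_prod // [RHS](reindex_inj (mulfI a0)) /=.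
  apply: eq_big => [b|b _]; first by rewrite mulf_eq0 (negPf a0).
  by rewrite gpush_comp.
have ww' : w * w' = 1.
  rewrite -big_split big1 //= => b b0; by rewrite -gpushM // uu' gpush1.
have wE := unit_invariant ww' (inv u) (inv u').
have wr : \prod_(b : 'F_7 | b != 0) gpush b (gred u) = gC (w 0)%:~R.
  transitivity (gred w).
    by rewrite rmorph_prod; apply: eq_bigr => b _; rewrite /= gred_push.
  by rewrite {1}wE gredC.
have := @dlog_prod _ (fun b : 'F_7 => b != 0) (fun b => gpush b (gred u))
  (fun b => gpush b (gred u')).
rewrite wr gderC mulr0 => e; rewrite [RHS]e.
  by apply: eq_bigr => b b0; rewrite gpushM // gder_push // mulrCA.
by move=> b b0; rewrite -gpushM // -rmorphM uu' rmorph1 gpush1.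
Qed.

End GaloisNorm.

(** The last condition makes c affine away from 0: c(j) = c(1) - (j - 1) n for j = 1, ..., 6.
    Antisymmetry at j = 1 and the coefficient of t in the Galois sum are then two independent linear
    equations in c(1) and n. *)
Lemma log_kernel (c : gring 'F_7) (n : 'F_7) :
  (forall j : 'F_7, j != 0 -> c (- j) = - c j) ->
  \sum_(b : 'F_7 | b != 0) gC b * gpush b c = 0 ->
  (forall j : 'F_7, j != 0 -> j != 1 -> c (j - 1) - c j = n) ->
  forall j, j != 0 -> c j = 0.
Proof.
move=> odd gal ap.
have h7 : 7 = 0 :> 'F_7 by apply/val_inj.
have {}gal : c 1 + 2 * c 4 + 3 * c 5 + 4 * c 2 + 5 * c 3 + 6 * c 6 = 0.
  have : \sum_(b : 'F_7) b * c b^-1 = 0.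
    rewrite (bigD1 0) //= mul0r add0r.
    have := congr1 (fun f : gring 'F_7 => f 1) gal.
    rewrite gring_sumE gring0E => e; rewrite -[RHS]e.
    by apply: eq_bigr => b _; rewrite gCmulE gpushE mul1r.
  rewrite sum_F7 mul0r add0r invr1 mul1r.
  have -> : 2^-1 = 4 :> 'F_7 by apply/val_inj; vm_compute.
  have -> : 3^-1 = 5 :> 'F_7 by apply/val_inj; vm_compute.
  have -> : 4^-1 = 2 :> 'F_7 by apply/val_inj; vm_compute.
  have -> : 5^-1 = 3 :> 'F_7 by apply/val_inj; vm_compute.
  by have -> : 6^-1 = 6 :> 'F_7 by apply/val_inj; vm_compute.
have {}odd : c 6 = - c 1 by rewrite -odd //; congr (c _); apply/val_inj.
have step (j : 'F_7) : j != 0 -> j != 1 -> c j = c (j - 1) - n.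
  by move=> j0 j1; rewrite -(ap j) // subKr.
have c2 : c 2 = c 1 - n by rewrite step //; congr (c _ - _); apply/val_inj.
have c3 : c 3 = c 2 - n by rewrite step //; congr (c _ - _); apply/val_inj.
have c4 : c 4 = c 3 - n by rewrite step //; congr (c _ - _); apply/val_inj.
have c5 : c 5 = c 4 - n by rewrite step //; congr (c _ - _); apply/val_inj.
have c6 : c 6 = c 5 - n by rewrite step //; congr (c _ - _); apply/val_inj.
have n0 : n = 0.
  (* After substitution the Galois sum is 21 c(1) - 62 n, which is n modulo 7. *)
  have -> : n = (c 1 + 2 * c 4 + 3 * c 5 + 4 * c 2 + 5 * c 3 + 6 * c 6)
    - 7 * (3 * c 1) + 7 * (9 * n) by rewrite c6 c5 c4 c3 c2; ring.
  by rewrite gal h7; ring.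
have c1 : c 1 = 0.
  (* Here c(6) + c(1) = 2 c(1) - 5 n, and 4 is the inverse of 2 modulo 7. *)
  have -> : c 1 = 4 * (c 6 + c 1) - 7 * c 1 + 20 * n.
    by rewrite c6 c5 c4 c3 c2; ring.
  by rewrite odd n0 h7; ring.
move: c2 c3 c4 c5 c6; rewrite n0 !subr0 c1 => c2; rewrite c2 => c3.
rewrite c3 => c4; rewrite c4 => c5; rewrite c5 => c6 j.
case: j => -[|[|[|[|[|[|[|//]]]]]]] jlt j0 //.
- by rewrite -c1; congr (c _); apply/val_inj.
- by rewrite -c2; congr (c _); apply/val_inj.
- by rewrite -c3; congr (c _); apply/val_inj.
- by rewrite -c4; congr (c _); apply/val_inj.
- by rewrite -c5; congr (c _); apply/val_inj.
- by rewrite -c6; congr (c _); apply/val_inj.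
Qed.

(** * Torsion up to the norm element *)

Lemma nat_Zp7 (b : 'F_7) : (b : nat)%:R = b. Proof. exact: natr_Zp. Qed.

(** The quotient (t^n - 1) / (t - 1). With r the representative of 1/k, the torsion R_k is (t - 1)^2
    times [geo _ r]. *)
Definition geo (S : comNzRingType) (n : nat) : gring S :=
  \sum_(i < n) gX S 1 ^+ i.

Lemma geoE (S : comNzRingType) (n : nat) :
  (gX S 1 - 1) * geo S n = gX S n%:R - 1.
Proof. by rewrite -subrX1 gXn. Qed.

Lemma geo_F7 (S : comNzRingType) (b : 'F_7) :
  (gX S 1 - 1) * geo S b = gX S b - 1.
Proof. by rewrite geoE nat_Zp7. Qed.

Lemma gred_geo n : gred (geo _ n) = geo _ n.
Proof.
by rewrite rmorph_sum; apply: eq_bigr => i _; rewrite rmorphXn /= gredX.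
Qed.

(** The augmentation is b, so by [pow7] the seventh power is the non-zero constant b. *)
Lemma geo_unit (b : 'F_7) : b != 0 -> exists g, geo 'F_7 b * g = 1.
Proof.
move=> b0; exists (geo 'F_7 b ^+ 6 * gC b^-1).
rewrite mulrA -exprS pow7 -rmorphM /=.
suff -> : \sum_i geo 'F_7 b i = b by rewrite mulfV // rmorph1.
under eq_bigr do rewrite gring_sumE.
rewrite exchange_big /= -[RHS]nat_Zp7; transitivity (\sum_(i < b) (1 : 'F_7)).
  apply: eq_bigr => i _; under eq_bigr do rewrite gXn gXE.
  by rewrite (bigD1 (1 *+ i)) //= eqxx big1 ?addr0 // => j /negPf ->.
by rewrite sumr_const card_ord.
Qed.

(** The element w = (t - 1)(z - z') is a multiple of N with w N = 0. Since N N = 7 N and the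
    coefficients are integers, w = 0; the remaining factor t - 1 can be cancelled up to a multiple
    of N. Modulo 7 the first cancellation would fail. *)
Lemma cancel_X1_sqr (z z' : gring int) :
  (gX _ 1 - 1) * ((gX _ 1 - 1) * z) = (gX _ 1 - 1) * ((gX _ 1 - 1) * z') ->
  exists q, z = z' + gC q * norm_elt _.
Proof.
move=> zz'; set y := gX int 1 - 1; pose w := y * (z - z').
have /ann_X1 wE : y * w = 0.
  by rewrite /w !mulrBr zz' subrr.
have yN : y * norm_elt _ = 0 by rewrite mulrBl mul1r mulX_norm subrr.
have w0 : w = 0.
  have : w * norm_elt _ = 0 by rewrite /w mulrAC yN mul0r.
  rewrite {1}wE -mulrA mul_norm mulrA -rmorphM /=.
  move=> /(congr1 (fun f : gring int => f 0)).
  rewrite gCmulE norm_eltE mulr1 gring0E.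
  under eq_bigr do rewrite norm_eltE.
  rewrite sumr_const cardT size_enum_ord => w7.
  rewrite wE; suff -> : w 0 = 0 by rewrite rmorph0 mul0r.
  by move: w7; clear; move: (w 0) => a; lia.
have /ann_X1 zE : y * (z - z') = 0 by [].
by exists ((z - z') 0); rewrite -zE addrC subrK.
Qed.

Lemma push_nz (a : 'F_7) (a0 : a != 0) (x : ZG) : push a x = gpush a (x : gring int).
Proof.
apply/ffunP => n; rewrite gpushE ffunE.
have e i : (a * i == n) = (i == n / a).
  by rewrite -[RHS](inj_eq (mulfI a0)) [a * (n / a)]mulrC divfK.
by rewrite (eq_bigl _ _ e) big_pred1_eq.
Qed.

Lemma reidemeisterE (k : 'F_7) :
  reidemeister k = (gX _ k^-1 - 1) * (gX _ 1 - 1) :> gring int.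
Proof. by []. Qed.

Lemma shiftE i (x : ZG) : Defs.shift i x = gX _ i * (x : gring int) :> gring int.
Proof. by apply/ffunP => n; rewrite gXmulE ffunE. Qed.

(** For a = 0 the right side would be supported at the single exponent i, while R_k has non-zero
    coefficients at both 0 and 1. *)
Lemma torsion_push_neq0 (k a i : 'F_7) (x : ZG) : k != 0 ->
  reidemeister k = Defs.shift i (push a x) -> a != 0.
Proof.
move=> k0 e; apply/eqP => a0.
have Re (n : 'F_7) : reidemeister k n =
    (n == k^-1 + 1)%:R - (n == k^-1)%:R - (n == 1)%:R + (n == 0)%:R.
  rewrite reidemeisterE mulrBr mulrBl mul1r mulr1 -gXD.
  by rewrite !(gringDE, gringNE) !gXE ?gring1E; ring.
have supp n : reidemeister k n != 0 -> n = i.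
  rewrite e a0 !ffunE; apply: contra_neq_eq => ni.
  by rewrite big_pred0 // => j; rewrite mul0r eq_sym subr_eq0 (negPf ni).
have r0 : (0 == k^-1) = false by rewrite eq_sym invr_eq0; apply: negPf.
have r1 : (1 == k^-1 + 1) = false by rewrite eq_sym -subr_eq0 addrK eq_sym.
have /supp i0 : reidemeister k 0 != 0.
  by rewrite Re r0; case: (0 == _ + 1).
have /supp i1 : reidemeister k 1 != 0.
  by rewrite Re r1; case: (1 == k^-1).
by move: i1; rewrite -i0.
Qed.

(** The torsion relation divided by (t - 1)^2: with r = 1/k, the image of R_k is (t^(a r) - 1)(t^a -
    1), and each factor is t - 1 times a [geo]. *)
Lemma torsion_geo (k k' a i : 'F_7) (U : ZG) (a0 : a != 0) :
  reidemeister k' = Defs.shift i (push a (Defs.conv (reidemeister k) U)) ->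
  exists q, geo int k'^-1%R =
    gX _ i * geo _ (a * k^-1)%R * geo _ a * gpush a (U : gring int) + gC q * norm_elt _.
Proof.
rewrite push_nz // shiftE.
rewrite -[Defs.conv _ _]/((reidemeister k : gring int) * (U : gring int)).
rewrite gpushM // !reidemeisterE gpushM // !gpushB // gpush1 // !gpushX // mulr1 => e.
apply: cancel_X1_sqr; rewrite geo_F7 mulrC e.
by rewrite -(geo_F7 _ (a * k^-1)) -(geo_F7 _ a); ring.
Qed.

Lemma X1_norm (m : 'F_7) : (gX _ m - 1) * norm_elt _ = 0 :> A7.
Proof. by rewrite mulrBl mulX_norm mul1r subrr. Qed.

(** Obtained by differentiating (t^m - 1) N = 0. *)
Lemma X1_gder_norm (m : 'F_7) :
  (gX _ m - 1) * gder (norm_elt _) = - gC m * norm_elt _.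
Proof.
have := congr1 gder (X1_norm m).
rewrite gderM !raddfB /= gderX gder1 subr0.
rewrite raddf0 -mulrA mulX_norm addrC => /eqP; rewrite addr_eq0 => /eqP ->.
by rewrite mulNr.
Qed.

(** The difference of the logarithmic derivatives is P' Q' (Q D P - P D Q) = q P' Q' (Q D N - N D
    Q). The factor t^m - 1 kills N and turns D N into - m N, and every multiple of N is a constant
    times N. *)
Lemma dlog_congr_norm (m q : 'F_7) (P P' Q Q' : A7) :
  P * P' = 1 -> Q * Q' = 1 -> P = Q + gC q * norm_elt _ ->
  exists e, (gX _ m - 1) * (P' * gder P) =
    (gX _ m - 1) * (Q' * gder Q) + gC e * norm_elt _.
Proof.
move=> PP' QQ' PQ.
have DP : gder P = gder Q + gC q * gder (norm_elt _).
  by rewrite PQ raddfD /= gderM gderC mul0r add0r.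
exists (\sum_i (P' * Q' * gC q * - gC m * Q) i); rewrite -mul_norm.
apply: (canRL (addNKr _)); rewrite addrC.
transitivity ((gX _ m - 1) * (P' * Q' * (Q * gder P - P * gder Q))).
  transitivity ((gX _ m - 1) * (P' * gder P * (Q * Q') - Q' * gder Q * (P * P'))).
    by rewrite QQ' PP' !mulr1; ring.
  by ring.
rewrite DP PQ.
transitivity (P' * Q' * gC q * (Q * ((gX _ m - 1) * gder (norm_elt _))
   - gder Q * ((gX _ m - 1) * norm_elt _))); first by ring.
by rewrite X1_norm X1_gder_norm; ring.
Qed.

Lemma dlogM (x x' y y' : A7) : x * x' = 1 -> y * y' = 1 ->
  x' * y' * gder (x * y) = x' * gder x + y' * gder y.
Proof.
move=> xx' yy'; rewrite gderM.
transitivity (x' * gder x * (y * y') + y' * gder y * (x * x')); first by ring.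
by rewrite xx' yy' !mulr1.
Qed.

(* Formally (t^m - 1) dlog(t^b - 1), where m = b n. *)
Definition power_sum (b : 'F_7) (n : nat) : A7 :=
  gC b * \sum_(j < n) gX _ (b * j.+1%:R).

Lemma power_sumE b n :
  (gX _ b - 1) * power_sum b n = gC b * gX _ b * (gX _ (b * n%:R) - 1).
Proof.
have -> : gX 'F_7 (b * n%:R) = gX _ b ^+ n by rewrite gXn mulr_natr.
rewrite subrX1 /power_sum; have -> : \sum_(j < n) gX 'F_7 (b * j.+1%:R) =
    gX _ b * \sum_(j < n) gX _ b ^+ j.
  rewrite big_distrr; apply: eq_bigr => j _ /=.
  by rewrite gXn -gXD -mulrS mulr_natr.
by ring.
Qed.

(** Formally, t^b - 1 is t - 1 times [geo _ b], and logarithmic derivatives add up. As t - 1 is not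
    invertible, the difference E of both sides is shown to be annihilated by t - 1, which makes it a
    multiple of N. *)
Lemma power_sum_dlog (b : 'F_7) (n n' : nat) (g : A7) :
  geo _ b * g = 1 -> b * n%:R = n'%:R ->
  exists e, power_sum b n =
    power_sum 1 n' + (gX _ n'%:R - 1) * (g * gder (geo _ b)) + gC e * norm_elt _.
Proof.
move=> bg bn; set m : 'F_7 := n'%:R.
pose E := power_sum b n - (power_sum 1 n' + (gX _ m - 1) * (g * gder (geo _ b))).
have Dgeo : (gX _ 1 - 1) * gder (geo 'F_7 b) =
    gC b * gX _ b - gX _ 1 * geo _ b.
  have := congr1 gder (geo_F7 'F_7 b).
  rewrite gderM !raddfB /= !gder1 !gderX.
  by rewrite !subr0 rmorph1 mul1r => <-; ring.
have /ann_X1 EE : (gX _ 1 - 1) * E = 0.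
  transitivity ((gX _ 1 - 1) * E * (geo _ b * g)); first by rewrite bg mulr1.
  transitivity (g * (((gX _ 1 - 1) * geo _ b) * power_sum b n
     - ((gX _ 1 - 1) * power_sum 1 n') * geo _ b
     - (gX _ m - 1) * ((gX _ 1 - 1) * gder (geo _ b)) * (geo _ b * g))).
    by rewrite /E; ring.
  rewrite geo_F7 !power_sumE Dgeo bg bn mul1r rmorph1 -/m; ring.
by exists (E 0); rewrite -EE /E; ring.
Qed.

(* Delta(t^l) = c(t / t_2) t_2^l for c = [coprod_form (1/k) al be], where al = l
   and be = k l mod 7. *)
Definition coprod_form (r : 'F_7) (al be : nat) : A7 := power_sum 1 al + power_sum r be.

(** All four power sums are expressed by [power_sum_dlog] through [power_sum 1 m] and a term (t^m -
    1) dlog [geo], where m = a l. What remains is the logarithmic derivative of the divided torsion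
    relation, multiplied by t^m - 1 and valid up to N by [dlog_congr_norm]. *)
Lemma coprod_form_push (a r r' l i : 'F_7) (al be al' be' : nat) (u u' : gring int) (q : int) :
  a != 0 -> r != 0 -> r' != 0 -> u * u' = 1 ->
  al%:R = l -> r * be%:R = l -> al'%:R = a * l -> r' * be'%:R = a * l ->
  geo int r' = gX _ i * geo _ (a * r)%R * geo _ a * gpush a u + gC q * norm_elt _ ->
  exists e f, coprod_form r' al' be' =
    gC a * gpush a (coprod_form r al be + (gX _ l - 1) * (gred u' * gder (gred u)))
    + gC e * norm_elt _ + gC f * (gX _ (a * l) - 1).
Proof.
move=> a0 r0 r'0 uu' hal hbe hal' hbe' tors.
have [g1 g1E] := geo_unit (isT : (1 : 'F_7) != 0).
have [gr' gr'E] := geo_unit r'0.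
have [ga gaE] := geo_unit a0.
have [gar garE] : exists g, geo 'F_7 (a * r)%R * g = 1.
  by apply: geo_unit; rewrite mulf_neq0.
set m := a * l.
have [|e1 E1] := @power_sum_dlog 1 al' m g1 g1E; first by rewrite mul1r hal' nat_Zp7.
have [|e2 E2] := @power_sum_dlog r' be' m gr' gr'E; first by rewrite hbe' nat_Zp7.
have [|e3 E3] := @power_sum_dlog a al m ga gaE; first by rewrite hal nat_Zp7.
have [|e4 E4] := @power_sum_dlog (a * r) be m gar garE; first by rewrite -mulrA hbe nat_Zp7.
have power_sum_push b n : gC a * gpush a (power_sum b n) = power_sum (a * b) n.
  rewrite /power_sum (gpushM a0) (gpushC a0) rmorphM mulrA; congr (_ * _).
  rewrite gpush_sum; apply: eq_bigr => j _.
  by rewrite (gpushX _ a0) mulrA.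
pose v := gpush a (gred u); pose v' := gpush a (gred u').
have vv' : v * v' = 1 by rewrite -gpushM // -rmorphM uu' rmorph1 gpush1.
have dv : v' * gder v = gC a * gpush a (gred u' * gder (gred u)).
  by rewrite (gder_push a0) (gpushM a0) mulrCA.
have XX : gX 'F_7 i * gX _ (- i) = 1 by rewrite -gXD subrr.
pose Q := gX 'F_7 i * geo _ (a * r)%R * geo _ a * v.
pose Q' := gX 'F_7 (- i) * gar * ga * v'.
have h1 : gX 'F_7 i * geo _ (a * r)%R * (gX _ (- i) * gar) = 1.
  by rewrite mulrACA XX garE mulr1.
have h2 : gX 'F_7 i * geo _ (a * r)%R * geo _ a * (gX _ (- i) * gar * ga) = 1.
  by rewrite mulrACA h1 gaE mulr1.
have QQ' : Q * Q' = 1 by rewrite mulrACA h2 vv' mulr1.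
have dQ : Q' * gder Q = gC i + gar * gder (geo _ (a * r)%R) +
    ga * gder (geo _ a) + v' * gder v.
  rewrite (dlogM h2 vv') (dlogM h1 gaE) (dlogM XX garE) gderX.
  by rewrite mulrCA (mulrC (gX _ (- i)) (gX _ i)) XX mulr1.
have [|e E] := @dlog_congr_norm m q%:~R _ _ _ _ gr'E QQ'.
  rewrite -gred_geo tors !(rmorphD, rmorphM) /= gredX !gred_geo gred_push gred_norm.
  by rewrite gredC.
(* The factor t^i of the torsion relation has logarithmic derivative i and leaves the term i (t^m -
   1). *)
exists (e + e1 + e2 - e3 - e4), i.
have geo1 : gder (geo 'F_7 (1%R : 'F_7)) = 0.
  by rewrite /geo big_ord_recl big_ord0 expr0 addr0 gder1.
have -> : gpush a (coprod_form r al be + (gX _ l - 1) * (gred u' * gder (gred u))) =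
   gpush a (power_sum 1 al) + gpush a (power_sum r be) +
   (gX _ m - 1) * gpush a (gred u' * gder (gred u)).
  rewrite (gpushD a (coprod_form _ _ _)) (gpushD a (power_sum 1 al)); congr (_ + _).
  by rewrite (gpushM a0 (gX _ l - 1)) (gpushB a (gX _ l)) (gpush1 _ a0) (gpushX _ a0 l).
rewrite !mulrDr !power_sum_push mulr1 [gC a * (_ * _)]mulrCA -dv.
move: E; rewrite dQ => E.
rewrite /coprod_form E1 E2 E3 E4 geo1 nat_Zp7 -/m E.
rewrite !(rmorphD, rmorphB) /=; ring.
Qed.

(** * The target of the coproduct *)

Local Notation rels := <<target_relations>>%VS.

(* c(t / t_2) t_2^l *)
Definition emb (l : 'F_7) (c : A7) : Omega2 := \sum_j c j *: Defs.gen j (l - j).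

Lemma embD l c d : emb l (c + d) = emb l c + emb l d.
Proof.
by rewrite /emb -big_split; apply: eq_bigr => j _; rewrite gringDE scalerDl.
Qed.

Lemma embC l s c : emb l (gC s * c) = s *: emb l c.
Proof.
by rewrite /emb scaler_sumr; apply: eq_bigr => j _; rewrite gCmulE scalerA.
Qed.

Lemma embB l c d : emb l (c - d) = emb l c - emb l d.
Proof.
rewrite embD; congr (_ + _); rewrite -[RHS]scaleN1r -embC; congr emb.
by rewrite rmorphN rmorph1 mulN1r.
Qed.

Lemma embX l i : emb l (gX _ i) = Defs.gen i (l - i).
Proof.
rewrite /emb (bigD1 i) //= gXE eqxx scale1r big1 ?addr0 // => j /negPf ji.
by rewrite gXE ji scale0r.
Qed.

Lemma emb1_rel l : emb l 1 \in rels.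
Proof.
rewrite -gX0 embX subr0; apply: memv_span; rewrite !mem_cat.
by apply/orP; right; apply/orP; left; apply/fintype.imageP; exists l.
Qed.

Lemma embX_rel l : emb l (gX _ l) \in rels.
Proof.
rewrite embX subrr; apply: memv_span; rewrite !mem_cat.
by apply/orP; left; apply/fintype.imageP; exists l.
Qed.

Lemma emb_normE l : emb l (norm_elt _) = \sum_(j : 'F_7) Defs.gen (l + j) (- j).
Proof.
rewrite /emb (reindex_inj (addrI l)); apply: eq_bigr => j _.
by rewrite norm_eltE scale1r opprD addNKr.
Qed.

Lemma emb_norm_rel l : emb l (norm_elt _) \in rels.
Proof.
rewrite emb_normE; apply: memv_span; rewrite !mem_cat.
by apply/orP; right; apply/orP; right; apply/fintype.imageP; exists l.
Qed.

Lemma target_eqP (y z : Omega2) : (\pi_target y = \pi_target z) <-> (y - z \in rels).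
Proof.
rewrite -[y - z \in rels]/(y - z \in pred_of_vspace rels).
by rewrite Quotient.idealrBE; split=> [->|/eqP].
Qed.

Lemma push2_is_linear a : linear (push2 a).
Proof.
move=> s y z; rewrite /push2 scaler_sumr -big_split; apply: eq_bigr => p _.
rewrite scaler_sumr -big_split; apply: eq_bigr => q _ /=.
by rewrite !ffunE mulrDr scalerDl scalerA mulrCA.
Qed.

HB.instance Definition _ a :=
  GRing.isLinear.Build 'F_7 Omega2 Omega2 *:%R (push2 a) (push2_is_linear a).

Lemma push2_gen a p q : push2 a (Defs.gen p q) = a *: Defs.gen (a * p) (a * q).
Proof.
rewrite /push2 (bigD1 p) //= [X in _ + X]big1 ?addr0; last first.
  move=> p' /negPf pp'; rewrite big1 // => q' _.
  by rewrite ffunE xpair_eqE pp' mulr0 scale0r.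
rewrite (bigD1 q) //= big1 ?addr0 => [|q' /negPf qq'].
  by rewrite ffunE eqxx mulr1.
by rewrite ffunE xpair_eqE eqxx qq' mulr0 scale0r.
Qed.

Lemma push2_emb a l c : a != 0 -> push2 a (emb l c) = emb (a * l) (gC a * gpush a c).
Proof.
move=> a0; rewrite [RHS]/emb (reindex_inj (mulfI a0)) /emb linear_sum.
apply: eq_bigr => j _; rewrite linearZ /= push2_gen gCmulE gpushE.
have -> : a * j / a = j by rewrite mulrAC mulfV // mul1r.
by rewrite scalerA mulrBr [c j * a]mulrC.
Qed.

(** The generators of the relations are 1, t^l and N seen through [emb l], and the substitution maps
    each of these three families to multiples of itself. *)
Lemma push2_rel a y : a != 0 -> y \in rels -> push2 a y \in rels.
Proof.
move=> a0 /(@coord_span _ _ _ (in_tuple target_relations)) ->.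
rewrite linear_sum rpred_sum // => i _.
rewrite linearZ /= rpredZ //.
have : (in_tuple target_relations)`_i \in target_relations.
  by apply: mem_nth; exact: ltn_ord.
have g1 l : push2 a (emb l 1) \in rels.
  by rewrite push2_emb // gpush1 // embC rpredZ // emb1_rel.
have gl l : push2 a (emb l (gX _ l)) \in rels.
  by rewrite push2_emb // gpushX // embC rpredZ // embX_rel.
have gn l : push2 a (emb l (norm_elt _)) \in rels.
  rewrite push2_emb // embC rpredZ //.
  have -> : gpush a (norm_elt 'F_7) = norm_elt _.
    by apply/ffunP => n; rewrite gpushE !norm_eltE.
  exact: emb_norm_rel.
rewrite mem_cat => /orP[/fintype.imageP[l _ ->]|].
  by have := gl l; rewrite embX subrr.
rewrite mem_cat => /orP[/fintype.imageP[l _ ->]|/fintype.imageP[l _ ->]].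
  by have := g1 l; rewrite -gX0 embX subr0.
by have := gn l; rewrite emb_normE.
Qed.

Lemma target_pushE a y : a != 0 -> target_push a (\pi_target y) = \pi_target (push2 a y).
Proof.
move=> a0; apply/target_eqP; rewrite -linearB push2_rel //.
by apply/target_eqP; rewrite reprK.
Qed.

Lemma target_push_additive a : a != 0 -> {morph target_push a : y z / y + z}.
Proof.
move=> a0 y z; rewrite -[y]reprK -[z]reprK -(raddfD \pi_target) !target_pushE //.
by rewrite linearD raddfD.
Qed.

(** * The correction term and its kernel *)

Lemma starE x c : star x c =
  \sum_l (x l)%:~R *: emb l ((gX _ l - 1) * (c : A7)).
Proof.
rewrite /star; apply: eq_bigr => l _.
rewrite mulrBl mul1r embB scalerBr.
under eq_bigr do rewrite scalerBr; rewrite sumrB; congr (_ - _).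
  rewrite /emb scaler_sumr [RHS](reindex_inj (addrI l)); apply: eq_bigr => j _.
  by rewrite gXmulE [l + j]addrC addrK addrC opprD addrA subrr sub0r scalerA.
by rewrite /emb scaler_sumr; apply: eq_bigr => j _; rewrite scalerA.
Qed.

Lemma star_tpow l c : star (tpow l) c = emb l ((gX _ l - 1) * (c : A7)).
Proof.
rewrite starE (bigD1 l) //= ffunE eqxx scale1r big1 ?addr0 // => j /negPf jl.
by rewrite ffunE jl scale0r.
Qed.

Lemma ZG_unitP (v : ZG_unit) : ((val v).1 : gring int) * ((val v).2 : gring int) = 1.
Proof. by move/eqP: (valP v) => e; exact: e. Qed.

Lemma dlogE (v : ZG_unit) :
  dlog v = gred (val v).2 * gder (gred (val v).1) :> A7.
Proof.
apply/ffunP => n; rewrite gmulE ffunE; apply: eq_bigr => i _.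
by rewrite !ffunE.
Qed.

Lemma dennis_trace_eqP tau1 tau2 : dennis_trace tau1 = dennis_trace tau2 <->
  exists s, dlog (repr tau1) - dlog (repr tau2) = gC s :> A7.
Proof.
have -> : dennis_trace tau1 = dennis_trace tau2 <->
    dlog (repr tau1) - dlog (repr tau2) \in <[dt_over_t]>%VS.
  rewrite -[_ \in <[_]>%VS]/(_ \in pred_of_vspace <[dt_over_t]>%VS).
  by rewrite Quotient.idealrBE; split=> /eqP.
have dE s : s *: dt_over_t = gC s.
  by apply/ffunP => n; rewrite !ffunE; case: eqP => _; [exact: mulr1 | exact: mulr0].
split=> [/vlineP[s e]|[s e]]; first by exists s; rewrite -dE.
by apply/vlineP; exists s; rewrite dE.
Qed.

Lemma correction_eqP tau1 tau2 :
  (forall x, correction x tau1 = correction x tau2) <->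
  forall l, emb l ((gX _ l - 1) * ((dlog (repr tau1) - dlog (repr tau2)) : A7)) \in rels.
Proof.
split=> [h l|h x].
  by have /target_eqP := h (tpow l); rewrite !star_tpow -embB -mulrBr.
apply/target_eqP; rewrite !starE -sumrB rpred_sum // => l _.
by rewrite -scalerBr -embB -mulrBr rpredZ.
Qed.

(** On the line p + q = 1 the relations are spanned by 1 and t, which live at j = 0 and j = 1, and
    by N, whose coefficients are all equal. *)
Lemma rel_coef (y : Omega2) (j j' : 'F_7) : y \in rels ->
  j != 0 -> j != 1 -> j' != 0 -> j' != 1 -> y (j, 1 - j) = y (j', 1 - j').
Proof.
move=> /(@coord_span _ _ _ (in_tuple target_relations)) -> j0 j1 j'0 j'1.
rewrite !sum_ffunE; apply: eq_bigr => i _; rewrite !ffunE; congr (_ *: _).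
have : (in_tuple target_relations)`_i \in target_relations.
  by apply: mem_nth; exact: ltn_ord.
have sub0 (a : 'F_7) : a != 1 -> (1 - a == 0) = false.
  by move=> a1; rewrite subr_eq0 eq_sym; apply: negPf.
rewrite mem_cat => /orP[/fintype.imageP[l _ ->]|].
  by rewrite !ffunE !xpair_eqE !sub0 // !andbF.
rewrite mem_cat => /orP[/fintype.imageP[l _ ->]|/fintype.imageP[l _ ->]].
  by rewrite !ffunE !xpair_eqE (negPf j0) (negPf j'0).
rewrite -emb_normE.
have normE (a : 'F_7) : emb l (norm_elt _) (a, 1 - a) = (l == 1)%:R.
  rewrite sum_ffunE (bigD1 a) //= !ffunE xpair_eqE eqxx /= big1.
    by rewrite addr0 (inj_eq (addIr _)) eq_sym scale1r.
  by move=> i' /negPf i'a; rewrite !ffunE xpair_eqE eq_sym i'a scaler0.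
by rewrite !normE.
Qed.

Lemma emb_coef l c (j : 'F_7) : emb l c (j, l - j) = c j.
Proof.
rewrite sum_ffunE (bigD1 j) //= !ffunE eqxx big1 ?addr0.
  exact: mulr1.
by move=> i /negPf ij; rewrite !ffunE xpair_eqE eq_sym ij; exact: mulr0.
Qed.

Lemma correction_dennis tau1 tau2 :
  (forall x, correction x tau1 = correction x tau2) <->
  dennis_trace tau1 = dennis_trace tau2.
Proof.
rewrite correction_eqP dennis_trace_eqP.
set c : A7 := dlog (repr tau1) - dlog (repr tau2).
split=> [h|[s ->] l]; last first.
  rewrite mulrC embC rpredZ // embB rpredB //; [exact: embX_rel | exact: emb1_rel].
pose cc (v : ZG_unit) : A7 := gred (val v).2 * gder (gred (val v).1).
have cE : c = cc (repr tau1) - cc (repr tau2) by rewrite /c !dlogE.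
have odd (j : 'F_7) : j != 0 -> c (- j) = - c j.
  move=> j0; rewrite cE !gringDE !gringNE.
  by rewrite !(dlog_unit_odd (ZG_unitP _) j0) opprD.
have gal : \sum_(b : 'F_7 | b != 0) gC b * gpush b c = 0.
  rewrite cE.
  under eq_bigr do rewrite gpushB mulrBr.
  by rewrite sumrB !(dlog_unit_galois (ZG_unitP _)) subr0.
(* The relations over l = 1 make c(j - 1) - c(j) independent of j for j different from 0 and 1; the
   common value is read off at j = 2. *)
have c0 := @log_kernel c (c 1 - c 2) odd gal.
clearbody c; exists (c 0); apply/ffunP => j; rewrite [RHS]ffunE; case: eqP => [->//|/eqP j0].
apply: c0 j0 => i i0 i1.
have := rel_coef (h 1) i0 i1 (isT : 2 != 0 :> 'F_7) (isT : 2 != 1 :> 'F_7).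
rewrite !emb_coef !mulrBl !mul1r !gringDE !gringNE !gXmulE => ->.
by congr (c _ - _); apply/val_inj.
Qed.

(** * The transformation formula for coproducts of the expected form *)

Lemma correction_tpow l tau :
  correction (tpow l) tau = \pi_target (emb l ((gX _ l - 1) * (dlog (repr tau) : A7))).
Proof. by rewrite /correction star_tpow. Qed.

Lemma correction_additive tau : {morph correction^~ tau : x y / x + y}.
Proof.
move=> x y; rewrite /correction -raddfD /=; congr (\pi_target _).
rewrite !starE -big_split; apply: eq_bigr => l _ /=.
by rewrite ffunE rmorphD scalerDl.
Qed.

Lemma tpow_decomp (x : ZG) : x = \sum_l tpow l *~ x l.
Proof.
have mz z l n : (tpow l *~ z) n = (n == l)%:R * z.
  transitivity (tpow l n *~ z); last by rewrite -mulrzr intz ffunE.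
  by case: z => m; rewrite ?NegzE ?mulrNz -!pmulrn ?ffunE ffunMnE ?ffunE.
apply/ffunP => n; rewrite sum_ffunE (bigD1 n) //= mz eqxx mul1r big1 ?addr0 //.
by move=> l /negPf ln; rewrite mz eq_sym ln mul0r.
Qed.

Lemma push_tpow (a l : 'F_7) : a != 0 -> push a (tpow l) = tpow (a * l).
Proof. by move=> a0; rewrite push_nz //; exact: gpushX. Qed.

Lemma push_additive (a : 'F_7) : {morph push a : x y / x + y}.
Proof.
move=> x y; apply/ffunP => n; rewrite !ffunE -big_split.
by apply: eq_bigr => i _; rewrite ffunE.
Qed.

Lemma additive_ext (h : ZG -> target) : {morph h : x y / x + y} ->
  (forall l, h (tpow l) = 0) -> forall x, h x = 0.
Proof.
move=> hD ht x.
have h0 : h 0 = 0 by apply: (addrI (h 0)); rewrite -hD !addr0.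
have hB : zmod_morphism h.
  by move=> y z; apply/eqP; rewrite -subr_eq opprK -hD subrK.
pose H : {additive ZG -> target} := HB.pack h (GRing.isZmodMorphism.Build _ _ h hB).
rewrite -[h]/(H : ZG -> target) [x]tpow_decomp raddf_sum big1 // => l _.
by rewrite raddfMz /= ht mul0rz.
Qed.

(** What the algebra needs from the geometry. The weights are existential, as for k != 0 they matter
    only modulo 7: seven further terms of a power sum add a multiple of N. *)
Definition has_coproduct_form (k : 'F_7) (Delta : ZG -> target) :=
  forall l : 'F_7, exists al be : nat, [/\ al%:R = l, be%:R = k * l &
    Delta (tpow l) = \pi_target (emb l (coprod_form k^-1 al be))].

(** The difference of both sides is additive in x, which reduces the claim to x = t^l. There
    [coprod_form_push] gives equality up to multiples of N and of t^(a l) - 1, both of which are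
    relations over t^(a l). *)
Lemma coproduct_torsion (k k' a : 'F_7) (tau : Wh)
    (Delta Delta' : {additive ZG -> target}) : k != 0 -> k' != 0 ->
  is_whitehead_torsion k k' a tau ->
  has_coproduct_form k Delta -> has_coproduct_form k' Delta' ->
  forall x : ZG, Delta' (push a x) =
    target_push a (Delta x) + target_push a (correction x tau).
Proof.
move=> k0 k'0 [i tors] form form' x.
have a0 := torsion_push_neq0 k'0 tors.
have [q geoq] := torsion_geo a0 tors.
pose h x := Delta' (push a x) - (target_push a (Delta x) + target_push a (correction x tau)).
apply/eqP; rewrite -subr_eq0 -/(h x); apply/eqP.
move: x; apply: additive_ext => [x y|l].
  rewrite /h push_additive (raddfD Delta') (raddfD Delta) correction_additive.
  rewrite (target_push_additive a0 (Delta x)).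
  rewrite (target_push_additive a0 (correction x tau)).
  by rewrite [X in _ - X]addrACA opprD addrACA.
rewrite /h push_tpow //.
have [al [be [alE beE ->]]] := form l.
have [al' [be' [al'E be'E ->]]] := form' (a * l).
have uu' := ZG_unitP (repr tau).
have [| |e [f ->]] := @coprod_form_push a k^-1 k'^-1 l i al be al' be' _ _ q a0
  (invr_neq0 k0) (invr_neq0 k'0) uu' alE _ al'E _ geoq.
- by rewrite beE mulKf.
- by rewrite be'E mulKf.
rewrite correction_tpow -target_push_additive // -raddfD /= -embD target_pushE //.
rewrite push2_emb // dlogE.
apply/eqP; rewrite subr_eq0; apply/eqP/target_eqP.
rewrite -embB; set L := gC a * _.
rewrite -[L + _ + _]addrA [L + _]addrC addrK embD !embC rpredD // rpredZ //.
  exact: emb_norm_rel.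
by rewrite embB rpredB ?embX_rel ?emb1_rel.
Qed.

(** * Differentials of C^1 maps *)

Section C1Calculus.
Variables (R : realType) (V : normedModType R).

(** Continuous differentiability together with an explicit differential, so that one application of
    the rules below yields both [C1] and the value of ['d]. *)
Definition has_C1_diff (W : normedModType R) (f : V -> W) (df : V -> V -> W) : Prop :=
  (forall x, is_diff x f (df x)) /\ (forall v, continuous (fun x => df x v)).

Lemma has_C1_diff_C1 (W : normedModType R) (f : V -> W) df :
  has_C1_diff f df -> C1 f.
Proof.
move=> [fd fc]; split=> [x|v]; first by apply: (@ex_diff _ _ _ _ _ _ _ (fd x)).
have -> : (fun x => 'd f x v) = (fun x => df x v).
  by apply/funext => x; rewrite (@diff_val _ _ _ _ _ _ _ (fd x)).
exact: fc.
Qed.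

Lemma has_C1_diffE (W : normedModType R) (f : V -> W) df x v :
  has_C1_diff f df -> 'd f x v = df x v.
Proof. by move=> [fd _]; rewrite (@diff_val _ _ _ _ _ _ _ (fd x)). Qed.

Lemma has_C1_diff_cts (W : normedModType R) (f : V -> W) df :
  has_C1_diff f df -> continuous f.
Proof.
move=> [fd _] x; apply: differentiable_continuous.
exact: (@ex_diff _ _ _ _ _ _ _ (fd x)).
Qed.

Lemma C1_diff_cst (W : normedModType R) (a : W) : has_C1_diff (fun=> a) (fun _ _ => 0).
Proof. by split=> [x|v]; [exact: is_diff_cst | exact: cst_continuous]. Qed.

Lemma C1_diff_lin (W : normedModType R) (f : {linear V -> W}) :
  continuous f -> has_C1_diff f (fun=> f).
Proof.
move=> fc; split=> [x|v]; last exact: cst_continuous.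
by apply: DiffDef; [exact: linear_differentiable | rewrite diff_lin].
Qed.

Lemma C1_diffD (W : normedModType R) (f g : V -> W) df dg :
  has_C1_diff f df -> has_C1_diff g dg ->
  has_C1_diff (fun x => f x + g x) (fun x v => df x v + dg x v).
Proof.
move=> [fd fc] [gd gc]; split=> [x|v x]; first exact: is_diffD.
by apply: cvgD; [exact: fc | exact: gc].
Qed.

Lemma C1_diffM (f g : V -> R) df dg :
  has_C1_diff f df -> has_C1_diff g dg ->
  has_C1_diff (fun x => f x * g x) (fun x v => f x * dg x v + g x * df x v).
Proof.
move=> hf hg; have fcts := has_C1_diff_cts hf; have gcts := has_C1_diff_cts hg.
case: hf hg => [fd fc] [gd gc]; split=> [x|v x]; first exact: is_diffM.
apply: cvgD; apply: cvgM; first exact: fcts.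
- exact: gc.
- exact: gcts.
- exact: fc.
Qed.

Lemma C1_diffZ (W : normedModType R) (f : V -> R) df (w : W) :
  has_C1_diff f df -> has_C1_diff (fun x => f x *: w) (fun x v => df x v *: w).
Proof.
move=> [fd fc]; split=> [x|v x]; last by apply: cvgZr_tmp; exact: fc.
have fdx := @ex_diff _ _ _ _ _ _ _ (fd x).
apply: DiffDef; first exact: differentiableZl.
by rewrite diffZl // (@diff_val _ _ _ _ _ _ _ (fd x)).
Qed.

Lemma C1_diff_comp (h h' : R -> R) (f : V -> R) df :
  (forall y : R, is_derive y 1 h (h' y)) -> continuous h' -> has_C1_diff f df ->
  has_C1_diff (fun x => h (f x)) (fun x v => df x v * h' (f x)).
Proof.
move=> hd hc hf; have fcts := has_C1_diff_cts hf; case: hf => [fd fc].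
split=> [x|v x]; last first.
  by apply: cvgM; [exact: fc | apply: continuous_comp; [exact: fcts | exact: hc]].
have hdy y : is_diff y h ( *:%R ^~ (h' y)).
  have dh := @ex_derive _ _ _ _ _ _ _ (hd y).
  apply: DiffDef; first exact/derivable1_diffP.
  by rewrite deriv1E // derive1E (@derive_val _ _ _ _ _ _ _ (hd y)).
exact: (@is_diff_comp _ _ _ _ f (df x) h _ x).
Qed.

Lemma C1_diff_cos (f : V -> R) df : has_C1_diff f df ->
  has_C1_diff (fun x => cos (f x)) (fun x v => df x v * - sin (f x)).
Proof.
apply: (@C1_diff_comp (@cos R) (fun y => - sin y)).
by move=> z; apply: cvgN; exact: continuous_sin.
Qed.

Lemma C1_diff_sin (f : V -> R) df : has_C1_diff f df ->
  has_C1_diff (fun x => sin (f x)) (fun x v => df x v * cos (f x)).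
Proof.
apply: (@C1_diff_comp (@sin R) (@cos R)).
exact: continuous_cos.
Qed.

Lemma C1_diff_eq (W : normedModType R) (f g : V -> W) df dg :
  has_C1_diff f df -> f =1 g -> (forall x, df x =1 dg x) -> has_C1_diff g dg.
Proof.
move=> hf /funext <- e; have <- // : df = dg.
by apply/funext => x; apply/funext => v; exact: e.
Qed.

End C1Calculus.

(** * Coordinates of R^4 *)

Section Vec4.
Variable R : realType.

Definition vec4 (a b c d : R) : 'rV[R]_4 := \row_(i < 4) [:: a; b; c; d]`_i.

Notation i2 := (inord 2 : 'I_4).
Notation i3 := (inord 3 : 'I_4).

Lemma vec4E a b c d : [/\ vec4 a b c d 0 0 = a, vec4 a b c d 0 1 = b,
  vec4 a b c d 0 i2 = c & vec4 a b c d 0 i3 = d].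
Proof. by split; rewrite mxE /= ?inordK. Qed.

Lemma vec4_eta (z : 'rV[R]_4) : z = vec4 (z 0 0) (z 0 1) (z 0 i2) (z 0 i3).
Proof.
apply/rowP => i; rewrite mxE; case: i => -[|[|[|[|//]]]] ilt /=;
  by congr (z _ _); apply: val_inj; rewrite /= ?inordK.
Qed.

Lemma vec4P a b c d a' b' c' d' : vec4 a b c d = vec4 a' b' c' d' ->
  [/\ a = a', b = b', c = c' & d = d'].
Proof.
move=> e; have := vec4E a b c d; rewrite e.
by have [-> -> -> ->] := vec4E a' b' c' d'; case.
Qed.

Lemma vec4D a b c d a' b' c' d' :
  vec4 a b c d + vec4 a' b' c' d' = vec4 (a + a') (b + b') (c + c') (d + d').
Proof. by apply/rowP => -[[|[|[|[|//]]]] ilt]; rewrite !mxE. Qed.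

Lemma vec4N a b c d : - vec4 a b c d = vec4 (- a) (- b) (- c) (- d).
Proof. by apply/rowP => -[[|[|[|[|//]]]] ilt]; rewrite !mxE. Qed.

Lemma vec4Z s a b c d : s *: vec4 a b c d = vec4 (s * a) (s * b) (s * c) (s * d).
Proof. by apply/rowP => -[[|[|[|[|//]]]] ilt]; rewrite !mxE. Qed.

Lemma vec4_dot a b c d a' b' c' d' :
  dot (vec4 a b c d) (vec4 a' b' c' d') = a * a' + b * b' + c * c' + d * d'.
Proof.
rewrite /dot !mxE !big_ord_recl big_ord0 !mxE /=; ring.
Qed.

Lemma rotate_vec4 s t a b c d :
  rotate s t (vec4 a b c d) =
  vec4 (cos (2 * pi * s) * a - sin (2 * pi * s) * b)
       (sin (2 * pi * s) * a + cos (2 * pi * s) * b)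
       (cos (2 * pi * t) * c - sin (2 * pi * t) * d)
       (sin (2 * pi * t) * c + cos (2 * pi * t) * d).
Proof. by rewrite /rotate; have [-> -> -> ->] := vec4E a b c d. Qed.

Lemma C1_diff_vec4 (V : normedModType R) (f0 f1 f2 f3 : V -> R) d0 d1 d2 d3 :
  has_C1_diff f0 d0 -> has_C1_diff f1 d1 -> has_C1_diff f2 d2 -> has_C1_diff f3 d3 ->
  has_C1_diff (fun x => vec4 (f0 x) (f1 x) (f2 x) (f3 x))
    (fun x v => vec4 (d0 x v) (d1 x v) (d2 x v) (d3 x v)).
Proof.
have vE a b c d : a *: vec4 1 0 0 0 + b *: vec4 0 1 0 0 + c *: vec4 0 0 1 0
    + d *: vec4 0 0 0 1 = vec4 a b c d.
  by rewrite !vec4Z !vec4D !(mulr0, mulr1, addr0, add0r).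
move=> h0 h1 h2 h3.
have h := C1_diffD (C1_diffD (C1_diffD (C1_diffZ (vec4 1 0 0 0) h0)
  (C1_diffZ (vec4 0 1 0 0) h1)) (C1_diffZ (vec4 0 0 1 0) h2))
  (C1_diffZ (vec4 0 0 0 1) h3).
by apply: (C1_diff_eq h) => [x|x v]; exact: vE.
Qed.

End Vec4.

(** * Angles measured in turns *)

Section Turns.
Variable R : realType.
Implicit Types (a b s t x y : R).

Definition cost s := cos (2 * pi * s : R).
Definition sint s := sin (2 * pi * s : R).

Lemma cost2Dsint2 s : cost s ^+ 2 + sint s ^+ 2 = 1.
Proof. exact: cos2Dsin2. Qed.

Lemma costD a b : cost (a + b) = cost a * cost b - sint a * sint b.
Proof. by rewrite /cost mulrDr cosD. Qed.

Lemma sintD a b : sint (a + b) = sint a * cost b + cost a * sint b.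
Proof. by rewrite /sint mulrDr sinD. Qed.

Lemma turn0 : cost 0 = 1 /\ sint 0 = 0.
Proof. by rewrite /cost /sint mulr0 cos0 sin0. Qed.

Lemma turn1 : cost 1 = 1 /\ sint 1 = 0.
Proof. by rewrite /cost /sint mulr1 mulr_natl cos2pi sin2pi. Qed.

Lemma turnDint a (n : int) : cost (a + n%:~R) = cost a /\ sint (a + n%:~R) = sint a.
Proof.
have step b : cost (b + 1) = cost b /\ sint (b + 1) = sint b.
  by rewrite costD sintD; have [-> ->] := turn1; split; ring.
have nat_case b m : cost (b + m%:R) = cost b /\ sint (b + m%:R) = sint b.
  elim: m => [|m [IHc IHs]]; first by rewrite addr0.
  by rewrite -natr1 addrA; have [-> ->] := step (b + m%:R).
case: n => m; first exact: nat_case.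
rewrite NegzE mulrNz; have := nat_case (a - m.+1%:R) m.+1.
by rewrite subrK => -[-> ->].
Qed.

(** After subtraction of the floor, injectivity of the cosine on [0, pi] settles the first half
    turn, and the symmetry d |-> 1 - d the second. *)
Lemma cost_eq1 a : cost a = 1 -> exists n : int, a = n%:~R.
Proof.
move=> c1; exists (Num.floor a); set n := Num.floor a.
have /andP[n1 n2] := floor_itv a; rewrite -/n in n1 n2.
have ad : a = (a - n%:~R) + n%:~R by rewrite subrK.
move: c1; rewrite ad; have [-> _] := turnDint (a - n%:~R) n.
rewrite intrD in n2; set d := a - n%:~R => c1.
have d0 : 0 <= d by rewrite /d subr_ge0.
have d1 : d < 1 by rewrite /d; lra.
have pi0 := pi_gt0 R.
suff -> : d = 0 by rewrite add0r.
have half b : 0 <= b -> b <= 1 / 2 -> cost b = 1 -> b = 0.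
  move=> b0 b1; have [c0 _] := turn0; rewrite -c0 => /cos_inj.
  rewrite !in_itv /= mulr0 lexx pi_ge0 => /(_ _ isT) e.
  have /eqP : 2 * pi * b = 0 by apply: e; nra.
  by rewrite !mulf_eq0 pnatr_eq0 (gt_eqF pi0) /= => /eqP.
have [dh|dh] := lerP d (1 / 2); first exact: half.
have /half : 0 <= 1 - d by lra.
move=> e; suff : 1 - d = 0 by lra.
apply: e; first by lra.
rewrite addrC; have [] := turnDint (- d) 1; rewrite mulr1z => -> _.
by rewrite /cost mulrN cosN.
Qed.

(** The angle a - b has cosine 1 by the addition formula. *)
Lemma turn_inj a b : cost a = cost b -> sint a = sint b ->
  exists n : int, a = b + n%:~R.
Proof.
move=> ec es; have [|n e] := @cost_eq1 (a - b).
  rewrite costD [cost (- b)]/cost [sint (- b)]/sint mulrN cosN sinN -/(cost b) -/(sint b).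
  by rewrite ec es mulrN opprK -!expr2 cost2Dsint2.
by exists n; rewrite -e addrC subrK.
Qed.

Lemma turn_polar x y : x ^+ 2 + y ^+ 2 = 1 -> exists s, x = cost s /\ y = sint s.
Proof.
move=> xy1; have x1 : -1 <= x <= 1 by apply/andP; split; nra.
have pi0 := pi_gt0 R.
have E b : 2 * pi * (b / (2 * pi)) = b by rewrite mulrC divfK // mulf_neq0 ?gt_eqF.
have [y0|y0] := lerP 0 y.
  exists (acos x / (2 * pi)); rewrite /cost /sint E acosK ?in_itv //= sin_acos //.
  by rewrite -xy1 addrAC subrr add0r sqrtr_sqr ger0_norm.
exists (- acos x / (2 * pi)); rewrite /cost /sint E cosN sinN acosK ?in_itv //=.
rewrite sin_acos // -xy1 addrAC subrr add0r sqrtr_sqr ltr0_norm //.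
by rewrite opprK.
Qed.

(** The equations compare (c + i s)(x + i y) with (c' + i s')(x + i y); multiplication by x - i y
    isolates the first factors. *)
Lemma plane_rotation_inj (c s c' s' x y : R) : x ^+ 2 + y ^+ 2 != 0 ->
  c * x - s * y = c' * x - s' * y -> s * x + c * y = s' * x + c' * y ->
  c = c' /\ s = s'.
Proof.
move=> xy0 e1 e2; split; apply: (mulIf xy0).
  transitivity ((c * x - s * y) * x + (s * x + c * y) * y); first by ring.
  by rewrite e1 e2; ring.
transitivity ((s * x + c * y) * x - (c * x - s * y) * y); first by ring.
by rewrite e1 e2; ring.
Qed.

Lemma int_frac (n : int) s t : 0 <= s < 1 -> 0 <= t < 1 -> s = t + n%:~R -> s = t.
Proof.
move=> /andP[s0 s1] /andP[t0 t1] e.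
have n1 : n%:~R < 1%:~R :> R by lra.
have n0 : (-1)%:~R < n%:~R :> R by rewrite mulrNz; lra.
move: n0 n1; rewrite !ltr_int => n0 n1; have n00 : n = 0 by lia.
by rewrite e n00 addr0.
Qed.

End Turns.

Lemma eqF7_mod (m n : nat) : m%:R = n%:R :> 'F_7 -> (m = n %[mod 7])%N.
Proof. by move=> /(congr1 val); rewrite /= !val_Fp_nat. Qed.

Lemma turn_F7 (R : realType) (m n : nat) : m%:R = n%:R :> 'F_7 ->
  cost (m%:R / 7 : R) = cost (n%:R / 7) /\ sint (m%:R / 7 : R) = sint (n%:R / 7).
Proof.
by move=> /eqF7_mod e; rewrite /cost /sint (cos_mod7 R e) (sin_mod7 R e).
Qed.

(** * The two coordinate planes of C^2 *)

Section Blocks.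
Variable R : realType.
Implicit Types (x y s t : R) (b : bool).

(* The plane z_2 = 0 for b = false, and z_1 = 0 for b = true. *)
Definition blk b x y : 'rV[R]_4 := if b then vec4 0 0 x y else vec4 x y 0 0.

Lemma rotate_blk s t b x y : let r := if b then t else s in
  rotate s t (blk b x y) =
  blk b (cost r * x - sint r * y) (sint r * x + cost r * y).
Proof. by case: b; rewrite /= rotate_vec4 !mulr0 subr0 addr0. Qed.

Lemma blkP b x y x' y' : blk b x y = blk b x' y' -> x = x' /\ y = y'.
Proof. by case: b => /vec4P[]. Qed.

Lemma blk_neg b x y x' y' : blk b x y = blk (~~ b) x' y' -> x = 0 /\ y = 0.
Proof. by case: b => /vec4P[]. Qed.

Lemma blkD b x y x' y' : blk b x y + blk b x' y' = blk b (x + x') (y + y').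
Proof. by case: b; rewrite /= vec4D !addr0. Qed.

Lemma blkN b x y : - blk b x y = blk b (- x) (- y).
Proof. by case: b; rewrite /= vec4N !oppr0. Qed.

Lemma blkZ b r x y : r *: blk b x y = blk b (r * x) (r * y).
Proof. by case: b; rewrite /= vec4Z !mulr0. Qed.

Lemma blk0 b : blk b 0 0 = 0.
Proof. by apply/rowP => -[[|[|[|[|//]]]] ilt]; case: b; rewrite !mxE. Qed.

Lemma blk_decomp b (u : 'rV[R]_4) :
  exists x y x' y', u = blk b x y + blk (~~ b) x' y'.
Proof.
rewrite [u]vec4_eta; case: b; rewrite /blk /=.
  exists (u 0 (inord 2)), (u 0 (inord 3)), (u 0 0), (u 0 1).
  by rewrite vec4D !addr0 !add0r.
exists (u 0 0), (u 0 1), (u 0 (inord 2)), (u 0 (inord 3)).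
by rewrite vec4D !addr0 !add0r.
Qed.

Lemma dotDl (u v w : 'rV[R]_4) : dot (u + v) w = dot u w + dot v w.
Proof. by rewrite /dot mulmxDl mxE. Qed.

Lemma dot_blk b x y x' y' : dot (blk b x y) (blk b x' y') = x * x' + y * y'.
Proof. by case: b; rewrite vec4_dot; ring. Qed.

Lemma dot_blk_neg b x y x' y' : dot (blk b x y) (blk (~~ b) x' y') = 0.
Proof. by case: b; rewrite vec4_dot; ring. Qed.

End Blocks.

(* Matrices given by lists of rows, so that the cofactor expansion computes. *)
Section Determinants.
Variable S : comPzRingType.

Definition rows_mx n (s : seq (seq S)) : 'M[S]_n :=
  \matrix_(i, j) nth 0 (nth [::] s i) j.

Definition minor_rows n (s : seq (seq S)) (j : nat) : seq (seq S) :=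
  mkseq (fun i => mkseq (fun j' => nth 0 (nth [::] s i.+1) (bump j j')) n) n.

Lemma det_rows_mx n s : \det (rows_mx n.+1 s) =
  \sum_(j < n.+1) nth 0 (nth [::] s 0) j *
    ((-1) ^+ j * \det (rows_mx n (minor_rows n s j))).
Proof.
rewrite (expand_det_row _ ord0); apply: eq_bigr => j _; rewrite mxE; congr (_ * (_ * \det _)).
by apply/matrixP => i j'; rewrite !mxE /minor_rows !nth_mkseq.
Qed.

Lemma det_rows_mx0 s : \det (rows_mx 0 s) = 1.
Proof. exact: det_mx00. Qed.

End Determinants.

Section BlockDeterminants.
Variable R : realType.

Lemma rowDet4_rows (a0 a1 a2 a3 b0 b1 b2 b3 c0 c1 c2 c3 d0 d1 d2 d3 : R) :
  rowDet4 (vec4 a0 a1 a2 a3) (vec4 b0 b1 b2 b3) (vec4 c0 c1 c2 c3) (vec4 d0 d1 d2 d3) =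
  \det (rows_mx 4 [:: [:: a0; a1; a2; a3]; [:: b0; b1; b2; b3];
                      [:: c0; c1; c2; c3]; [:: d0; d1; d2; d3]]).
Proof.
congr (\det _); apply/matrixP => -[[|[|[|[|//]]]] ilt] j; rewrite !mxE //=.
Qed.

Lemma row_mx_vec4 (a b c d t : R) :
  row_mx (vec4 a b c d) (t%:M : 'rV_1) = \row_(j < 5) nth 0 [:: a; b; c; d; t] j :> 'rV_5.
Proof.
apply/rowP => j; rewrite !mxE; case: splitP => i ij; rewrite mxE ij.
  by case: i ij => -[|[|[|[|//]]]] ilt.
by rewrite ord1.
Qed.

Lemma rowDet5_rows (a0 a1 a2 a3 a4 b0 b1 b2 b3 b4 c0 c1 c2 c3 c4
    d0 d1 d2 d3 d4 e0 e1 e2 e3 e4 : R) :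
  rowDet5 (vec4 a0 a1 a2 a3, a4) (vec4 b0 b1 b2 b3, b4) (vec4 c0 c1 c2 c3, c4)
    (vec4 d0 d1 d2 d3, d4) (vec4 e0 e1 e2 e3, e4) =
  \det (rows_mx 5 [:: [:: a0; a1; a2; a3; a4]; [:: b0; b1; b2; b3; b4];
    [:: c0; c1; c2; c3; c4]; [:: d0; d1; d2; d3; d4]; [:: e0; e1; e2; e3; e4]]).
Proof.
rewrite /rowDet5 /= !row_mx_vec4.
by congr (\det _); apply/matrixP => -[[|[|[|[|[|//]]]]] ilt] j; rewrite !mxE.
Qed.

(** A block determinant. Exchanging the two planes is an even permutation of the coordinates, so the
    sign does not depend on b. *)
Lemma rowDet4_blk b (x y x' y' p q p' q' : R) :
  rowDet4 (blk b x y) (blk b x' y') (blk (~~ b) p q) (blk (~~ b) p' q') =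
  (x * y' - y * x') * (p * q' - q * p').
Proof.
by case: b; rewrite /blk /= rowDet4_rows;
  do 4 rewrite !det_rows_mx !big_ord_recl big_ord0 /= !(mul0r, add0r, addr0);
  rewrite !det_rows_mx0 /bump /=; ring.
Qed.

Lemma rowDet5_blk b (x y x' y' t p q p' q' : R) :
  rowDet5 (blk b x y, 0) (blk b x' y', 0) (blk b 0 0, t)
    (blk (~~ b) p q, 0) (blk (~~ b) p' q', 0) =
  t * (x * y' - y * x') * (p * q' - q * p').
Proof.
by case: b; rewrite /blk /= rowDet5_rows;
  do 5 rewrite !det_rows_mx !big_ord_recl big_ord0 /= !(mul0r, add0r, addr0);
  rewrite !det_rows_mx0 /bump /=; ring.
Qed.

End BlockDeterminants.

(** * Linear loops in lens spaces *)

Section LinearFlow.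
Variables (R : realType) (al be : nat).
Implicit Types (q w : 'rV[R]_4 * R) (x y s t : R) (b : bool).

Definition rate b : nat := if b then be else al.

Definition flow q : 'rV[R]_4 := rotate (al%:R * q.2 / 7) (be%:R * q.2 / 7) q.1.

(** The vector (i al z_1, i be z_2); the velocity of the flow at time 0 is 2 pi / 7 times it. *)
Definition flow_field (z : 'rV[R]_4) : 'rV[R]_4 :=
  vec4 (- (al%:R * z 0 1)) (al%:R * z 0 0)
       (- (be%:R * z 0 (inord 3))) (be%:R * z 0 (inord 2)).

Definition flow_diff q w : 'rV[R]_4 :=
  rotate (al%:R * q.2 / 7) (be%:R * q.2 / 7) w.1 +
  (2 * pi / 7 * w.2) *: rotate (al%:R * q.2 / 7) (be%:R * q.2 / 7) (flow_field q.1).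

Lemma rotate_add s t (u v : 'rV[R]_4) : rotate s t (u + v) = rotate s t u + rotate s t v.
Proof.
rewrite [u]vec4_eta [v]vec4_eta vec4D !rotate_vec4 vec4D.
by congr vec4; ring.
Qed.

Lemma C1_diff_coord (j : 'I_4) :
  has_C1_diff (fun q => q.1 0 j) (fun _ w => w.1 0 j).
Proof.
have lin : linear (fun q => q.1 0 j : R) by move=> a u v; rewrite !mxE.
pose f : {linear ('rV[R]_4 * R)%type -> R} :=
  HB.pack (fun q => q.1 0 j : R) (GRing.isLinear.Build _ _ _ _ _ lin).
have -> : (fun q => q.1 0 j) = f by [].
apply: C1_diff_lin => q; apply: (@continuous_comp _ _ _ fst (fun z : 'rV[R]_4 => z 0 j)).
  exact: cvg_fst.
exact: coord_continuous.
Qed.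

Lemma C1_diff_angle (c : R) : has_C1_diff (fun q => 2 * pi * (c * q.2 / 7))
  (fun _ w => 2 * pi * (c * w.2 / 7)).
Proof.
have snd_cts : continuous (@snd 'rV[R]_4 R) by move=> q; exact: cvg_snd.
have h := C1_diff_lin (f := snd) snd_cts.
apply: (C1_diff_eq (C1_diffM (C1_diff_cst _ (2 * pi * c / 7)) h)) => [q|q w] /=.
  by field.
by rewrite mulr0 addr0; field.
Qed.

Lemma flow_C1_diff : has_C1_diff flow flow_diff.
Proof.
have ca c := C1_diff_cos (C1_diff_angle c).
have sa c := C1_diff_sin (C1_diff_angle c).
have N := C1_diff_cst ('rV[R]_4 * R)%type (-1 : R).
have h1 c i j := C1_diffD (C1_diffM (ca c) (C1_diff_coord i))
  (C1_diffM (C1_diffM N (sa c)) (C1_diff_coord j)).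
have h2 c i j := C1_diffD (C1_diffM (sa c) (C1_diff_coord i))
  (C1_diffM (ca c) (C1_diff_coord j)).
apply: (C1_diff_eq (C1_diff_vec4 (h1 al%:R 0 1) (h2 al%:R 0 1)
  (h1 be%:R (inord 2) (inord 3)) (h2 be%:R (inord 2) (inord 3)))) => [q|q w].
  by rewrite /flow [in RHS](vec4_eta q.1) rotate_vec4; congr vec4; ring.
rewrite /flow_diff [in RHS](vec4_eta w.1) /flow_field !rotate_vec4 vec4Z vec4D.
by congr vec4; field.
Qed.

Lemma flow_field_blk b x y :
  flow_field (blk b x y) = blk b (- ((rate b)%:R * y)) ((rate b)%:R * x).
Proof.
rewrite /flow_field; case: b => /=.
  by have [-> -> -> ->] := vec4E 0 0 x y; rewrite !mulr0 oppr0.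
by have [-> -> -> ->] := vec4E x y 0 0; rewrite !mulr0 oppr0.
Qed.

Lemma sphere_blk b x y : sphere (blk b x y) <-> x ^+ 2 + y ^+ 2 = 1.
Proof. by rewrite /sphere /= dot_blk -!expr2. Qed.

Lemma dot_rotate s t (z : 'rV[R]_4) : dot (rotate s t z) (rotate s t z) = dot z z.
Proof.
rewrite [z]vec4_eta rotate_vec4 !vec4_dot.
have hs := cos2Dsin2 (2 * pi * s); have ht := cos2Dsin2 (2 * pi * t).
transitivity ((cos (2 * pi * s) ^+ 2 + sin (2 * pi * s) ^+ 2) *
    (z 0 0 * z 0 0 + z 0 1 * z 0 1) +
  (cos (2 * pi * t) ^+ 2 + sin (2 * pi * t) ^+ 2) *
    (z 0 (inord 2) * z 0 (inord 2) + z 0 (inord 3) * z 0 (inord 3))).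
  by ring.
by rewrite hs ht; ring.
Qed.

Lemma rotate_int s t (m n : int) (z : 'rV[R]_4) :
  rotate (s + m%:~R) (t + n%:~R) z = rotate s t z.
Proof.
rewrite [z]vec4_eta !rotate_vec4.
have [] := turnDint s m; have [] := turnDint t n; rewrite /cost /sint.
by move=> -> -> -> ->.
Qed.

End LinearFlow.

(** The summand 7 keeps the speed positive also for l = 0, so that the loops have non-zero velocity
    at time 0. *)
Definition weight1 (l : 'F_7) : nat := (l + 7)%N.

(* If both e(al t / 7) = e(p / 7) and e(be t / 7) = e(k p / 7), then be - k al = 7
   makes t an integer: the sphere is never entirely self-intersecting. *)
Definition weight2 (k l : 'F_7) : nat := (k * weight1 l + 7)%N.

(* The j-th deck transformation turns the plane z_1 = 0 by k j / 7. *)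
Definition deck_num (k : 'F_7) (b : bool) (p : 'F_7) : nat := if b then (k * p)%N else p.

(* The class of the circle in the plane, as a loop in L(k,7). *)
Definition circle_coef (k : 'F_7) (b : bool) : 'F_7 := if b then k^-1 else 1.

(** * The linear section over t^l and its self-intersections *)

Section LensSection.
Variables (R : realType) (k l : 'F_7).
Hypothesis k0 : k != 0.
Implicit Types (q w : 'rV[R]_4 * R) (x y s t : R) (b : bool) (p : 'F_7).

Notation al := (weight1 l).
Notation be := (weight2 k l).
Notation dnum := (deck_num k).
Notation coef := (circle_coef k).
Notation rate := (rate al be).
Notation A := (@flow R al be).

Lemma coef_neq0 b : coef b != 0.
Proof. by case: b; rewrite /= ?invr_neq0 ?oner_eq0. Qed.

(** This makes [coef b * p] the deck transformation that turns the plane b by p / 7 of a turn. *)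
Lemma dnum_F7 b p : (dnum b (coef b * p))%:R = p.
Proof.
by case: b; rewrite /deck_num /circle_coef ?natrM !natr_Zp ?mulVKf ?mul1r.
Qed.

Lemma rate_gt0 b : (0 < rate b)%N. Proof. by case: b; rewrite /= addn_gt0 orbT. Qed.

Lemma rate_neq0 b : (rate b)%:R != 0 :> R.
Proof. by rewrite pnatr_eq0 -lt0n rate_gt0. Qed.

Lemma deck_blk b p x y : let r : R := (dnum b p)%:R / 7 in
  deck k p (blk b x y) = blk b (cost r * x - sint r * y) (sint r * x + cost r * y).
Proof. by rewrite /deck rotate_blk; case: b. Qed.

Lemma flow_blk b x y t : let r := (rate b)%:R * t / 7 in
  A (blk b x y, t) = blk b (cost r * x - sint r * y) (sint r * x + cost r * y).
Proof. by rewrite /flow rotate_blk; case: b. Qed.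

Lemma flow_loop_section : loop_section k l A.
Proof.
split=> [|z zS]; first exact: has_C1_diff_C1 (flow_C1_diff R al be).
split=> [|t|t|t].
- by rewrite /flow /= !mulr0 mul0r rotate0.
- by rewrite /sphere /= dot_rotate.
- rewrite /flow /deck rotateD /=.
  (* In one period the angles gain l / 7 + 1 and k l / 7 + k + 1 turns, which are the angles of the
     l-th deck transformation up to whole turns. *)
  have -> : al%:R * (t + 1) / 7 = l%:R / 7 + al%:R * t / 7 + 1%:~R :> R.
    by rewrite /weight1 natrD; field.
  have -> : be%:R * (t + 1) / 7 = (k * l)%N%:R / 7 + be%:R * t / 7 + (k + 1)%N%:Z%:~R :> R.
    by rewrite /weight2 /weight1 -pmulrn !natrD !natrM !natrD; field.
  by rewrite rotate_int.
- by rewrite /flow /deck /= !rotateD; congr (rotate _ _ _); rewrite addrC.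
Qed.

Lemma turn_nondeg p t : 0 < t < 1 ->
  ~ (forall b, exists n : int, (rate b)%:R * t / 7 = (dnum b p)%:R / 7 + n%:~R).
Proof.
move=> /andP[t0 t1] h; have [n /= hn] := h false; have [m /= hm] := h true.
have beE : be%:R = k%:R * al%:R + 7 :> R by rewrite /weight2 natrD natrM.
(* In 7 t = be t - k al t the contributions of p cancel. *)
have tE : t = (m - k%:Z * n)%:~R.
  have e1 : al%:R * t = p%:R + 7 * n%:~R by rewrite -[LHS](divfK (x := 7)) // hn; field.
  have e2 : be%:R * t = (k * p)%N%:R + 7 * m%:~R by rewrite -[LHS](divfK (x := 7)) // hm; field.
  rewrite intrB intrM -pmulrn; apply: (mulfI (x := 7)) => //.
  transitivity (be%:R * t - k%:R * (al%:R * t)); first by rewrite beE; ring.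
  by rewrite e2 e1 natrM; ring.
move: t0 t1; rewrite tE -[0]/(0%:~R) -[1]/(1%:~R) !ltr_int => t0 t1; lia.
Qed.

(** Agreement of the two rotations in the other plane as well would contradict [turn_nondeg]. The
    gap makes the normal derivative invertible on that plane. *)
Lemma turn_gap b p t : 0 < t < 1 ->
  cost ((rate b)%:R * t / 7) = cost ((dnum b p)%:R / 7) ->
  sint ((rate b)%:R * t / 7) = sint ((dnum b p)%:R / 7) ->
  0 < (cost ((rate (~~ b))%:R * t / 7) - cost ((dnum (~~ b) p)%:R / 7)) ^+ 2 +
      (sint ((rate (~~ b))%:R * t / 7) - sint ((dnum (~~ b) p)%:R / 7)) ^+ 2.
Proof.
move=> t01 ec es; rewrite lt_neqAle addr_ge0 ?sqr_ge0 // andbT eq_sym.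
rewrite paddr_eq0 ?sqr_ge0 // !sqrf_eq0 !subr_eq0; apply/negP => /andP[/eqP ec' /eqP es'].
apply: (@turn_nondeg p t t01) => b'; apply: turn_inj;
  by case: b b' ec es ec' es' => -[] /= ec es ec' es'.
Qed.

(** A non-zero component in a plane forces the flow and the deck transformation to turn that plane
    equally. By [turn_nondeg] this cannot happen in both planes, so z lies in one of them; there
    [rate b * t] is an integer j congruent to [dnum b p] modulo 7. *)
Lemma flow_self_intersectionP p q : self_intersection k A p q ->
  exists b x y (j : nat), [/\ q = (blk b x y, j%:R / (rate b)%:R), x ^+ 2 + y ^+ 2 = 1,
    (0 < j < rate b)%N & p = coef b * j%:R].
Proof.
case: q => z t [/= zS t01 e].
have [x [y [x' [y' zE]]]] := blk_decomp false z.
have nondeg b u v u' v' : z = blk b u v + blk (~~ b) u' v' -> u ^+ 2 + v ^+ 2 != 0 ->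
    exists n : int, (rate b)%:R * t / 7 = (dnum b p)%:R / 7 + n%:~R.
  move=> zb uv0; move: e; rewrite zb {1}/flow {1}/deck !rotate_add !rotate_blk.
  have split4 (a0 a1 a2 a3 c0 c1 c2 c3 : R) :
    blk b a0 a1 + blk (~~ b) a2 a3 = blk b c0 c1 + blk (~~ b) c2 c3 ->
      a0 = c0 /\ a1 = c1.
    by case: (b); rewrite /= !vec4D => /vec4P[]; rewrite ?(addr0, add0r).
  move=> /split4[e1 e2]; apply: turn_inj.
    by have [] := plane_rotation_inj uv0 e1 e2; case: (b).
  by have [] := plane_rotation_inj uv0 e1 e2; case: (b).
have final b u v : z = blk b u v -> exists b x y (j : nat),
    [/\ (z, t) = (blk b x y, j%:R / (rate b)%:R), x ^+ 2 + y ^+ 2 = 1,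
    (0 < j < rate b)%N & p = coef b * j%:R].
  move=> zb; have uv1 : u ^+ 2 + v ^+ 2 = 1 by apply/(sphere_blk b); rewrite -zb.
  have [||n hn] := @nondeg b u v 0 0; first by rewrite blk0 addr0.
    by rewrite uv1 oner_eq0.
  have r0 : 0 < (rate b)%:R :> R by rewrite ltr0n rate_gt0.
  have tE : (rate b)%:R * t = ((dnum b p)%:Z + 7 * n)%:~R.
    rewrite intrD intrM -pmulrn -[LHS](divfK (x := 7)) // hn; by field.
  case/andP: t01 => t0 t1.
  have j0 : 0 < (dnum b p)%:Z + 7 * n by rewrite -(ltr0z R) -tE mulr_gt0.
  have j1 : (dnum b p)%:Z + 7 * n < (rate b)%:Z.
    by rewrite -(ltr_int R) -tE -pmulrn gtr_pMr.
  have [j jE] : exists j : nat, (dnum b p)%:Z + 7 * n = j%:Z.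
    by exists (absz ((dnum b p)%:Z + 7 * n)); rewrite gez0_abs // ltW.
  exists b, u, v, j; split=> //.
  - by congr pair => //; rewrite pmulrn -jE -tE mulrC mulKf ?gt_eqF.
  - by move: j0 j1; rewrite jE; lia.
  - have := congr1 (fun z : int => z%:~R : 'F_7) jE.
    rewrite intrD intrM -!pmulrn (_ : 7 = 0 :> 'F_7); last by apply/val_inj.
    rewrite mul0r addr0 -{1}[p](mulVKf (coef_neq0 b)) dnum_F7 => <-.
    by rewrite mulVKf // coef_neq0.
have [xy0|xy0] := eqVneq (x ^+ 2 + y ^+ 2) 0.
  apply: (final true x' y'); move: xy0; rewrite zE => /eqP.
  rewrite paddr_eq0 ?sqr_ge0 // !sqrf_eq0 => /andP[/eqP -> /eqP ->].
  by rewrite blk0 add0r.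
have [xy'0|xy'0] := eqVneq (x' ^+ 2 + y' ^+ 2) 0.
  apply: (final false x y); move: xy'0; rewrite zE => /eqP.
  rewrite paddr_eq0 ?sqr_ge0 // !sqrf_eq0 => /andP[/eqP -> /eqP ->].
  by rewrite blk0 addr0.
exfalso; apply: (@turn_nondeg p t t01) => -[].
  by apply: (@nondeg true x' y' x y) => //; rewrite addrC.
exact: (@nondeg false x y x' y').
Qed.

Lemma flow_turn b (j : nat) : let t : R := j%:R / (rate b)%:R in let p := coef b * j%:R in
  cost ((rate b)%:R * t / 7) = cost ((dnum b p)%:R / 7) /\
  sint ((rate b)%:R * t / 7) = sint ((dnum b p)%:R / 7).
Proof.
move=> t p; have -> : (rate b)%:R * t = j%:R by rewrite /t mulrC divfK // rate_neq0.
by apply: turn_F7; rewrite dnum_F7.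
Qed.

Lemma time_lt1 b (j : nat) : (0 < j < rate b)%N -> 0 < (j%:R / (rate b)%:R : R) < 1.
Proof.
move=> /andP[j0 jr]; have r0 : 0 < (rate b)%:R :> R by rewrite ltr0n rate_gt0.
apply/andP; split; first by apply: divr_gt0 => //; rewrite ltr0n.
by rewrite ltr_pdivrMr // mul1r ltr_nat.
Qed.

Lemma self_intersection_blk b x y (j : nat) : x ^+ 2 + y ^+ 2 = 1 -> (0 < j < rate b)%N ->
  self_intersection k A (coef b * j%:R) (blk b x y, j%:R / (rate b)%:R).
Proof.
move=> xy1 jr; split; [exact/sphere_blk | exact: time_lt1 |].
by rewrite flow_blk deck_blk; have [-> ->] := flow_turn b j.
Qed.

(** * Transversality and orientation at a self-intersection *)

Section AtSelfIntersection.
Variables (b : bool) (x y : R) (j : nat).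
Hypothesis xy1 : x ^+ 2 + y ^+ 2 = 1.
Hypothesis jr : (0 < j < rate b)%N.

Let t : R := j%:R / (rate b)%:R.
Let p : 'F_7 := coef b * j%:R.
Let q := (blk b x y, t).
Let c := cost ((rate b)%:R * t / 7).
Let s := sint ((rate b)%:R * t / 7).
Let X := c * x - s * y.
Let Y := s * x + c * y.
(** On the other plane, the flow at time t minus the deck transformation is complex multiplication
    by g + i h. *)
Let g := cost ((rate (~~ b))%:R * t / 7) - cost ((dnum (~~ b) p)%:R / 7).
Let h := sint ((rate (~~ b))%:R * t / 7) - sint ((dnum (~~ b) p)%:R / 7).
Let speed : R := 2 * pi / 7 * (rate b)%:R.

Lemma speed_gt0 : 0 < speed.
Proof. by rewrite /speed mulr_gt0 ?ltr0n ?rate_gt0 // divr_gt0 // mulr_gt0 ?pi_gt0. Qed.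

Lemma gap_gt0 : 0 < g ^+ 2 + h ^+ 2.
Proof.
have [ec es] := flow_turn b j.
exact: turn_gap (time_lt1 jr) ec es.
Qed.

Lemma XY1 : X ^+ 2 + Y ^+ 2 = 1.
Proof.
transitivity ((c ^+ 2 + s ^+ 2) * (x ^+ 2 + y ^+ 2)); first by rewrite /X /Y; ring.
by rewrite xy1 mulr1; exact: cost2Dsint2.
Qed.

(** In the plane b the two rotations agree and cancel, which leaves the velocity along the circle;
    in the other plane the velocity is 0 and the difference of the rotations remains. *)
Lemma normal_derivative_blk (v0 v1 v2 v3 tau : R) :
  normal_derivative k A p q (blk b v0 v1 + blk (~~ b) v2 v3, tau) =
  blk b (- (speed * tau * Y)) (speed * tau * X) +
  blk (~~ b) (g * v2 - h * v3) (h * v2 + g * v3).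
Proof.
have [ec es] := flow_turn b j.
rewrite /normal_derivative (has_C1_diffE _ _ (flow_C1_diff R al be)).
rewrite /flow_diff /deck /= flow_field_blk !rotate_add !rotate_blk.
have r1 (b' : bool) : (if b' then be%:R * t / 7 else al%:R * t / 7) = (rate b')%:R * t / 7.
  by case: b'.
have r2 (b' : bool) : (if b' then (k * p)%N%:R / 7 else p%:R / 7) = (dnum b' p)%:R / 7 :> R.
  by case: b'.
rewrite !r1 !r2 -ec -es -/t -/c -/s opprD !blkN blkZ.
rewrite addrAC [_ + _ + (_ + _)]addrACA !blkD addrAC blkD.
by congr (blk _ _ _ + blk _ _ _); rewrite /X /Y /g /h /speed; ring.
Qed.

Lemma flow_at : A q = blk b X Y. Proof. by rewrite flow_blk. Qed.

Lemma normal_derivative_onto (u : 'rV[R]_4) : dot u (A q) = 0 ->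
  exists2 w, dot w.1 q.1 = 0 & normal_derivative k A p q w = u.
Proof.
have [u0 [u1 [u2 [u3 ->]]]] := blk_decomp b u.
rewrite flow_at dotDl dot_blk -{2}[b]negbK dot_blk_neg addr0 => uX.
have D0 : g ^+ 2 + h ^+ 2 != 0 by rewrite gt_eqF // gap_gt0.
have sp0 : speed != 0 by rewrite gt_eqF // speed_gt0.
(* The other plane is handled by division by g + i h. In the plane b, u is a multiple of the unit
   tangent (- Y, X), which is reached in the time direction. *)
exists (blk b 0 0 + blk (~~ b) ((g * u2 + h * u3) / (g ^+ 2 + h ^+ 2))
   ((g * u3 - h * u2) / (g ^+ 2 + h ^+ 2)), (X * u1 - Y * u0) / speed).
  by rewrite /= blk0 add0r -{2}[b]negbK dot_blk_neg.
rewrite normal_derivative_blk; set D := g ^+ 2 + h ^+ 2 in D0 *.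
have -> : speed * ((X * u1 - Y * u0) / speed) = X * u1 - Y * u0.
  by rewrite mulrC divfK.
congr (blk _ _ _ + blk _ _ _).
- transitivity (u0 * (X ^+ 2 + Y ^+ 2) - X * (u0 * X + u1 * Y)); first by ring.
  by rewrite XY1 uX; ring.
- transitivity (u1 * (X ^+ 2 + Y ^+ 2) - Y * (u0 * X + u1 * Y)); first by ring.
  by rewrite XY1 uX; ring.
- by transitivity (D * u2 / D); [rewrite /D; ring | rewrite mulrAC mulfV // mul1r].
- by transitivity (D * u3 / D); [rewrite /D; ring | rewrite mulrAC mulfV // mul1r].
Qed.

Lemma positive_tangent_blk (r : R) : 0 < r ->
  positive_tangent k A p q (blk b (- (r * y)) (r * x), 0).
Proof.
(* The complement consists of the time direction, mapped to a positive multiple of the tangent of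
   the circle, and of the standard basis of the other plane, where multiplication by g + i h
   preserves the orientation. *)
move=> r0; exists (blk b 0 0, 1), (blk (~~ b) 1 0, 0), (blk (~~ b) 0 1, 0) => /=.
have nd := normal_derivative_blk.
have -> : normal_derivative k A p q (blk b 0 0, 1) = blk b (- (speed * Y)) (speed * X).
  rewrite -[blk b 0 0]addr0 -(blk0 R (~~ b)) nd.
  by rewrite !(mulr0, mulr1, oppr0, blk0, addr0).
have -> : normal_derivative k A p q (blk (~~ b) 1 0, 0) = blk (~~ b) g h.
  rewrite -[blk (~~ b) 1 0]add0r -{1}(blk0 R b) nd.
  by rewrite !(mulr0, mul0r, mulr1, oppr0, blk0, add0r, addr0).
have -> : normal_derivative k A p q (blk (~~ b) 0 1, 0) = blk (~~ b) (- h) g.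
  rewrite -[blk (~~ b) 0 1]add0r -{1}(blk0 R b) nd.
  by rewrite !(mulr0, mul0r, mulr1, oppr0, blk0, add0r, addr0).
have dot0 v0 v1 : dot (blk (~~ b) v0 v1) (blk b x y) = 0.
  by rewrite -{2}[b]negbK dot_blk_neg.
split=> //.
- by rewrite dot_blk !mul0r addr0.
- rewrite flow_at rowDet4_blk.
  have -> : (X * (speed * X) - Y * - (speed * Y)) * (g * g - h * - h) =
    speed * (X ^+ 2 + Y ^+ 2) * (g ^+ 2 + h ^+ 2) by ring.
  by rewrite XY1 mulr1 mulr_gt0 ?speed_gt0 ?gap_gt0.
- rewrite rowDet5_blk.
  have -> : 1 * (x * (r * x) - y * - (r * y)) * (1 * 1 - 0 * 0) =
    r * (x ^+ 2 + y ^+ 2) by ring.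
  by rewrite xy1 mulr1.
Qed.

End AtSelfIntersection.

Lemma flow_transverse : transverse k A.
Proof.
split=> [z zS|p q].
  rewrite (has_C1_diffE _ _ (flow_C1_diff R al be)) /flow_diff /=.
  have r0 s t : rotate s t (0 : 'rV[R]_4) = 0.
    by apply: (addrI (rotate s t 0)); rewrite -rotate_add !addr0.
  rewrite r0 add0r !mulr0 !mul0r rotate0 mulr1 scaler_eq0 negb_or; apply/andP; split.
    by rewrite gt_eqF // divr_gt0 // mulr_gt0 ?pi_gt0.
  apply/eqP => e; move: zS; rewrite /sphere /= [z]vec4_eta vec4_dot.
  move: e; rewrite /flow_field -(blk0 R false) => /vec4P[].
  have al0 := rate_neq0 false; have be0 := rate_neq0 true.
  move=> /eqP; rewrite oppr_eq0 mulf_eq0 (negPf al0) => /eqP -> /eqP.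
  rewrite mulf_eq0 (negPf al0) => /eqP -> /eqP.
  rewrite oppr_eq0 mulf_eq0 (negPf be0) => /eqP -> /eqP.
  rewrite mulf_eq0 (negPf be0) => /eqP ->; rewrite !mulr0 !addr0 => /eqP.
  by rewrite eq_sym oner_eq0.
move=> /(flow_self_intersectionP)[b [x [y [j [-> xy1 jr ->]]]]] u.
exact: normal_derivative_onto.
Qed.

(** * The self-intersection circles and their sum *)

Definition circle b (j : nat) s : 'rV[R]_4 * R :=
  (blk b (cost (s / 7)) (sint (s / 7)), j%:R / (rate b)%:R).

Lemma circle_C1_diff b j : has_C1_diff (circle b j)
  (fun s v => (blk b (- (2 * pi / 7 * v * sint (s / 7))) (2 * pi / 7 * v * cost (s / 7)), 0)).
Proof.
have ha : has_C1_diff (fun s => 2 * pi * (s / 7) : R) (fun _ v => 2 * pi * (v / 7)).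
  have h := C1_diff_lin (V := R) (f := idfun) (fun z => @cvg_id _ _).
  apply: (C1_diff_eq (C1_diffM (C1_diff_cst _ (2 * pi / 7 : R)) h)) => [s|s v] /=.
    by field.
  by rewrite mulr0 addr0; field.
have z0 := C1_diff_cst R (0 : R).
have hblk : has_C1_diff (fun s => blk b (cost (s / 7)) (sint (s / 7)))
   (fun s v => blk b (- (2 * pi / 7 * v * sint (s / 7))) (2 * pi / 7 * v * cost (s / 7))).
  case: b; rewrite /blk.
    apply: (C1_diff_eq (C1_diff_vec4 z0 z0 (C1_diff_cos ha) (C1_diff_sin ha))) => // s v.
    by rewrite /cost /sint; congr vec4; field.
  apply: (C1_diff_eq (C1_diff_vec4 (C1_diff_cos ha) (C1_diff_sin ha) z0 z0)) => // s v.
  by rewrite /cost /sint; congr vec4; field.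
case: hblk => hd hc; split=> [s|v s].
  have hp := is_diff_pair (hd s) (is_diff_cst (j%:R / (rate b)%:R : R) s).
  by apply: (is_diff_eq hp); apply/funext.
have c0 : (fun=> 0 : R) @ s --> (0 : R) by exact: cvg_cst.
exact: (cvg_pair (hc v s) c0).
Qed.

(** One period in s is a seventh of a turn, which on the plane b is the deck transformation [coef b]
    by [dnum_F7]; the curve closes up in the lens space with that class. *)
Lemma circle_oriented b j : (0 < j < rate b)%N ->
  oriented_circle k A (coef b * j%:R) (coef b) (circle b j).
Proof.
move=> jr; split; first exact: has_C1_diff_C1 (circle_C1_diff b j).
move=> s; have cs1 := cost2Dsint2 (s / 7); split.
- exact: self_intersection_blk.
- rewrite /circle deck_blk /=.
  have [ec es] : cost ((dnum b (coef b))%:R / 7 : R) = cost (1%:R / 7) /\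
      sint ((dnum b (coef b))%:R / 7 : R) = sint (1%:R / 7).
    by apply: turn_F7; rewrite -[coef b]mulr1 dnum_F7.
  rewrite ec es; have -> : (s + 1) / 7 = 1%:R / 7 + s / 7 by rewrite mulrDl addrC.
  by rewrite costD sintD.
- rewrite (has_C1_diffE _ _ (circle_C1_diff b j)) mulr1.
  by apply: positive_tangent_blk => //; rewrite divr_gt0 // mulr_gt0 ?pi_gt0.
Qed.

Definition ncircles := (al.-1 + be.-1)%N.

(** The circles in z_2 = 0 come first, then those in z_1 = 0. The successor leaves out time 0, so
    that j runs from 1 to [rate b] - 1. *)
Definition circle_index (i : 'I_ncircles) : bool * nat :=
  match fintype.split i with inl a => (false, a.+1) | inr a => (true, a.+1) end.

Lemma circle_index_range i : (0 < (circle_index i).2 < rate (circle_index i).1)%N.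
Proof.
rewrite /circle_index; case: fintype.splitP => a _ /=; have := ltn_ord a.
  by rewrite /weight1; lia.
by rewrite /weight2; lia.
Qed.

Lemma circle_index_inj : injective circle_index.
Proof.
move=> i i'; rewrite /circle_index => e; apply: (can_inj (@splitK _ _)).
by move: e; case: (fintype.split i) => a; case: (fintype.split i') => a' [] // /val_inj ->.
Qed.

Lemma circle_index_onto b (j : nat) : (0 < j < rate b)%N ->
  exists i, circle_index i = (b, j).
Proof.
case: b => /andP[j0 jr].
  have h : (j.-1 < be.-1)%N by move: j0 jr; rewrite /= /weight2; lia.
  exists (rshift _ (Ordinal h)); rewrite /circle_index.
  by rewrite (unsplitK (inr (Ordinal h))) /= prednK.
have h : (j.-1 < al.-1)%N by move: j0 jr; rewrite /= /weight1; lia.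
exists (lshift _ (Ordinal h)); rewrite /circle_index.
by rewrite (unsplitK (inl (Ordinal h))) /= prednK.
Qed.

Definition circle_sum : Omega2 :=
  \sum_(i < ncircles) let: (b, j) := circle_index i in
    coef b *: Defs.gen (coef b * j%:R) (l - coef b * j%:R).

Lemma flow_coproduct_class : coproduct_class k l A circle_sum.
Proof.
pose pp i := coef (circle_index i).1 * (circle_index i).2%:R.
pose mm i := coef (circle_index i).1.
pose cc i := circle (circle_index i).1 (circle_index i).2.
exists ncircles, pp, mm, cc; split.
- by move=> i; apply: circle_oriented; exact: circle_index_range.
- move=> r q /(flow_self_intersectionP)[b [x [y [j [-> xy1 jr ->]]]]].
  have [sg [xE yE]] := turn_polar xy1.
  have [i iE] := circle_index_onto jr.
  (* The fractional part s of 7 sg is the parameter on the circle; the integral part, modulo 7,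
     gives the deck transformation, and its multiples of 7 are whole turns. *)
  pose n := Num.floor (7 * sg); pose nn := absz (n %% 7)%Z.
  have nE : n = (n %/ 7)%Z * 7 + nn%:Z.
    by rewrite {1}(divz_eq n 7) /nn gez0_abs // modz_ge0.
  pose s := 7 * sg - n%:~R.
  have s01 : 0 <= s < 1.
    have /andP[n1 n2] := floor_itv (7 * sg); rewrite -/n in n1 n2.
    by rewrite intrD in n2; apply/andP; rewrite /s; split; lra.
  have sgE : sg = nn%:R / 7 + s / 7 + ((n %/ 7)%Z)%:~R.
    by rewrite /s {1}nE intrD intrM -!pmulrn; field.
  exists (i, s); split=> [|[i' s'] [/= pi' s'01 [jj' qE]]].
    split=> //=; first by rewrite /pp iE.
    exists (coef b * nn%:R); rewrite /cc iE /circle /= deck_blk.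
    have [ec es] : cost ((dnum b (coef b * nn%:R))%:R / 7 : R) = cost (nn%:R / 7) /\
      sint ((dnum b (coef b * nn%:R))%:R / 7 : R) = sint (nn%:R / 7).
      by apply: turn_F7; rewrite dnum_F7.
    rewrite ec es -costD -sintD xE yE sgE.
    by have [-> ->] := turnDint (nn%:R / 7 + s / 7) (n %/ 7)%Z.
  move: qE; rewrite /cc; have := circle_index_range i'.
  case i'E : (circle_index i') => [b' j'] /= jr' [].
  rewrite deck_blk -costD -sintD => zE tE.
  (* For uniqueness, the point determines in turn its plane, since z is not 0, its time and hence j,
     and its angle up to whole turns and deck transformations. *)
  have bb' : b' = b.
    apply/eqP; apply: contraT => nb; exfalso; move: xy1 zE.
    have -> : b' = ~~ b by apply/eqP; move: nb; case: (b'); case: (b).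
    move=> xy1 /blk_neg[x0 y0]; move: xy1; rewrite x0 y0 expr0n addr0 => /eqP.
    by rewrite eq_sym oner_eq0.
  have jj : j' = j.
    move: tE; rewrite bb' => /(congr1 (fun z => z * (rate b)%:R)).
    by rewrite !divfK ?rate_neq0 // => /eqP; rewrite eqr_nat => /eqP.
  have ii : i = i' by apply: circle_index_inj; rewrite iE i'E bb' jj.
  congr pair => //; move: zE; rewrite bb' => /blkP[cE sE].
  rewrite xE in cE; rewrite yE in sE.
  have [e eE] := turn_inj cE sE.
  apply: (@int_frac _ ((dnum b jj')%:Z + 7 * e - n) _ _ s01 s'01).
  rewrite intrB intrD intrM -!pmulrn /s eE; by field.
- rewrite /circle_sum; apply: eq_bigr => i _; rewrite /mm /pp.
  by case: (circle_index i).
Qed.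

Lemma circle_sumE : circle_sum =
  \sum_(j < al.-1) Defs.gen j.+1%:R (l - j.+1%:R) +
  \sum_(j < be.-1) k^-1 *: Defs.gen (k^-1 * j.+1%:R) (l - k^-1 * j.+1%:R).
Proof.
rewrite /circle_sum big_split_ord /=; congr (_ + _); apply: eq_bigr => j _.
  by rewrite /circle_index (unsplitK (inl j)) /circle_coef scale1r mul1r.
by rewrite /circle_index (unsplitK (inr j)).
Qed.

Lemma string_coproduct_tpow (Delta : {additive ZG -> target}) :
  is_string_coproduct R k Delta ->
  Delta (tpow l) = (\pi_target circle_sum)%qT.
Proof.
move=> h; apply: (h l A); first exact: flow_loop_section.
  exact: flow_transverse.
exact: flow_coproduct_class.
Qed.

End LensSection.

(** * The string coproduct in algebraic form *)

(** The power sum runs to j = n, whereas the circles stop at j = n - 1 because time 1 is excluded.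
    Since b n = l, the extra term is b t^l, a relation of the target. *)
Lemma emb_power_sum (l b : 'F_7) (n : nat) : (0 < n)%N -> b * n%:R = l ->
  emb l (power_sum b n) = \sum_(j < n.-1) b *: Defs.gen (b * j.+1%:R) (l - b * j.+1%:R)
    + b *: emb l (gX _ l).
Proof.
case: n => // n _ bn; rewrite /power_sum embC big_ord_recr /= embD bn scalerDr; congr (_ + _).
elim: n {bn} => [|n IH].
  rewrite !big_ord0; suff -> : emb l 0 = 0 by rewrite scaler0.
  by rewrite /emb big1 // => j _; rewrite gring0E scale0r.
by rewrite !big_ord_recr /= embD scalerDr IH embX.
Qed.

Lemma string_coproduct_form (R : realType) (k : 'F_7) (Delta : {additive ZG -> target}) :
  k != 0 -> is_string_coproduct R k Delta -> has_coproduct_form k Delta.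
Proof.
move=> k0 h l; have h7 : 7 = 0 :> 'F_7 by apply/val_inj.
have e1 : (weight1 l)%:R = l by rewrite /weight1 natrD natr_Zp h7 addr0.
have e2 : (weight2 k l)%:R = k * l.
  by rewrite /weight2 natrD natrM e1 natr_Zp h7 addr0.
exists (weight1 l), (weight2 k l); split=> //.
rewrite (string_coproduct_tpow l k0 h); apply/target_eqP.
rewrite circle_sumE /coprod_form embD.
rewrite (@emb_power_sum l 1) ?mul1r ?e1 //; last by rewrite addn_gt0 orbT.
rewrite (@emb_power_sum l k^-1) ?e2 ?mulKf //; last by rewrite addn_gt0 orbT.
under [X in _ - (X + _ + _)]eq_bigr do rewrite scale1r mul1r.
rewrite addrACA opprD addrA subrr sub0r rpredN -scalerDl rpredZ //.
exact: embX_rel.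
Qed.

Theorem proposition8 (R : realType) (k k' : 'F_7) (hk : k != 0) (hk' : k' != 0) :
  (forall (f : lens R k -> lens R k') (a : 'F_7) (tau : Wh)
          (Delta Delta' : {additive ZG -> target}),
     homotopy_equivalence R f ->
     orientation_preserving f ->
     pi1_action f a ->
     is_whitehead_torsion k k' a tau ->
     is_string_coproduct R k Delta ->
     is_string_coproduct R k' Delta' ->
     forall x : ZG,
       Delta' (push a x) =
         target_push a (Delta x) + target_push a (correction x tau)) /\
  (forall tau1 tau2 : Wh,
     (forall x : ZG, correction x tau1 = correction x tau2) <->
     dennis_trace tau1 = dennis_trace tau2).
Proof.
split=> [f a tau Delta Delta' _ _ _ tors h h'|]; last exact: correction_dennis.
exact: (coproduct_torsion hk hk' tors (string_coproduct_form hk h)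
  (string_coproduct_form hk' h')).
Qed.
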